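(* Let $G$ be a finitely generated group with a finite symmetric set of generators $\Gamma$, let $d\in\{0,1,2,\dots\}\cup\{\infty\}$ be the growth index of $G$, let $\{S_n\}_{n\ge0}$ be the symmetric random walk on $G$ with respect to $\Gamma$ started at the identity $e$, with law $\mathbf{P}$, and let $\mathcal{C}_n=\mathrm{Cap}(\{S_0,\dots,S_n\})$ be the capacity of its range. Then there is a (deterministic) constant $\mu_d\ge0$ such that $$\lim_{n\to\infty}\frac{\mathcal{C}_n}{n}=\mu_d\qquad \mathbf{P}\text{-a.s.}$$ Furthermore, $\mu_d=0$ if and only if $d\le4$.
   Context: Let $G$ be a group with a finite symmetric set of generators $\Gamma$ (i.e. $\Gamma=\Gamma^{-1}$). Let $\{X_n\}_{n\ge1}$ be independent random elements uniformly distributed on $\Gamma$; the symmetric random walk on $G$ with respect to $\Gamma$ is $S_0=g$, $S_{n+1}=S_nX_{n+1}$, with law denoted $\mathbf{P}_g$; $\mathbf{P}=\mathbf{P}_e$. Capacity: for a set $A\subseteq G$, let $\tau_A^+=\inf\{n\ge1: S_n\in A\}$ and $\mathrm{Cap}(A)=\sum_{g\in A}\mathbf{P}_g(\tau_A^+=\infty)$. The range is $\mathcal{R}_n=\{S_0,\dots,S_n\}$ (a random set) and $\mathcal{C}_n=\mathrm{Cap}(\mathcal{R}_n)$. Growth index: for $g\in G$ let $\rho(g)=\inf\{m\ge0: g=\gamma_1\cdots\gamma_m,\ \gamma_i\in\Gamma\}$ be the word length, and $\mathcal{V}(n)=|\{g\in G:\rho(g)\le n\}|$. The group has polynomial growth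 with growth index $d\in\{0,1,2,\dots\}$ if $\mathcal{V}(n)\asymp n^d$ (bounded above and below by positive constant multiples of $n^d$ for all $n\ge1$); it has superpolynomial growth, and by definition growth index $d=\infty$, if for every $q\ge0$ there is $c>0$ with $\mathcal{V}(n)\ge c\,n^q$ for all $n\ge1$. Every finitely generated group is of exactly one of these two types, and $d$ does not depend on $\Gamma$. The constant $\mu_d$ may depend on $G$ and $\Gamma$. *)

(* Defs.v *)
From HB Require Import structures.
From mathcomp Require Export all_boot all_order all_algebra monoid.
From mathcomp Require Export finmap.
From mathcomp Require Export all_classical all_reals all_analysis.
Export numFieldNormedType.Exports.
Set Implicit Arguments.
Unset Strict Implicit.
Unset Printing Implicit Defensive.
Import Order.TTheory GRing.Theory Num.Theory.
Local Open Scope classical_set_scope.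
Local Open Scope ring_scope.

(* The infimum of a set of natural numbers, as an extended real so that
   the infimum of the empty set is +oo. *)
Definition inf_nat (R : realType) (D : set nat) : \bar R :=
  ereal_inf [set n%:R%:E | n in D].

Section Growth.
Variables (R : realType) (G : groupType) (Gamma : {fset G}).

Definition symmetric_fset : Prop := [fset (x^-1)%g | x in Gamma]%fset = Gamma.

Definition is_word (m : nat) (g : G) : Prop :=
  exists s : m.-tuple G,
    all (fun x => x \in Gamma) s /\ g = (\prod_(x <- s) x)%g.

(* For a symmetric set, the subgroup it generates is the set of its words. *)
Definition generates : Prop := forall g : G, exists m, is_word m g.

Definition word_length (g : G) : \bar R := inf_nat R [set m | is_word m g].

(* [fset_set] sends an infinite set to the empty one; balls are finite since
   there are finitely many words of each length. *)
Definition volume (n : nat) : nat :=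
  #|` fset_set [set g : G | (word_length g <= n%:R%:E)%E]|%fset.

Definition polynomial_growth (d : nat) : Prop :=
  exists c C : R, [/\ 0 < c, 0 < C &
    forall n : nat, (1 <= n)%N ->
      c * n%:R ^+ d <= (volume n)%:R <= C * n%:R ^+ d].

Definition superpolynomial_growth : Prop :=
  forall q : R, 0 <= q -> exists2 c : R, 0 < c &
    forall n : nat, (1 <= n)%N -> c * n%:R `^ q <= (volume n)%:R.

End Growth.

Variant extnat := Fin of nat | Infty.

Definition extnat_le (d : extnat) (k : nat) : bool :=
  if d is Fin m then (m <= k)%N else false.

Definition has_growth_index (R : realType) (G : groupType) (Gamma : {fset G})
    (d : extnat) : Prop :=
  match d with
  | Fin m => polynomial_growth R Gamma m
  | Infty => superpolynomial_growth R Gamma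
  end.

Section Walk.
Variables (R : realType) (G : groupType) (Gamma : {fset G}).
Variables (disp : measure_display) (T : measurableType disp).
Variables (P : probability T R) (X : nat -> T -> G).

(* G carries the discrete sigma-algebra. *)
Definition random_elements : Prop :=
  forall (n : nat) (B : set G), measurable (X n @^-1` B).

Definition uniform_on : Prop :=
  forall (n : nat) (B : set G),
    P (X n @^-1` B) =
    ((#|` [fset x in Gamma | x \in B]|%fset)%:R / (#|` Gamma|%fset)%:R)%:E.

Definition mutually_independent : Prop :=
  forall (J : {fset nat}) (B : nat -> set G),
    P (\bigcap_(i in [set` J]) (X i @^-1` B i)) =
    (\prod_(i <- J) P (X i @^-1` B i))%E.

Definition iid_uniform_steps : Prop :=
  [/\ random_elements, uniform_on & mutually_independent].

(* The steps X_1, X_2, ... are indexed from 0: [X n] is the step X_{n+1}.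
   The law of [walk g] under P is P_g. *)
Fixpoint walk (g : G) (n : nat) (w : T) : G :=
  if n is m.+1 then (walk g m w * X m w)%g else g.

Definition return_time (A : set G) (g : G) (w : T) : \bar R :=
  inf_nat R [set n | (1 <= n)%N /\ A (walk g n w)].

Definition capacity (A : set G) : \bar R :=
  (\esum_(g in A) P [set w | return_time A g w = +oo])%E.

Definition walk_range (n : nat) (w : T) : set G :=
  [set walk 1%g k w | k in [set k | (k <= n)%N]].

(* The capacity is that of the realized range as a fixed set: the probabilities
   inside [capacity] average over walks unrelated to the outcome [w]. *)
Definition capacity_of_range (n : nat) (w : T) : \bar R :=
  capacity (walk_range n w).

End Walk.

(* Main.v *)
(**
wsize N A, the mean number of starting points from which the walk meets A by time N, is
the mean of |A T^-1| with T the trace of a walk of N steps. Its increments decrease to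
the capacity, so the capacity inherits monotonicity, subadditivity and left invariance
from this cardinality. Hence C_n is nondecreasing in n and C_(n+m) is at most the sum of
C_n and of an independent copy of C_m. With mu the limit of E C_n / n, subadditivity of
the second moment makes the variances of C_n / n summable along n = m 2^k, which with
Chebyshev, Borel-Cantelli and monotonicity gives almost sure convergence.

For two independent walks S and T, E C_n is the limit as N grows of 1/N times the mean
number of distinct values of S_i T_j^-1 for i <= n and j <= N. The collision probability
of two such values is a return probability, so with u_k the probability of return at
time 2k, mu > 0 as soon as the series of (k+1) u_k converges; conversely
mu <= 1/M + P(S and T meet fewer than M times) for every M. If the series diverges,
the second moment of the number of meetings is comparable to the square of the first
even when the walks start at distinct points, so restarting shows that they meet
infinitely often and mu = 0.

It remains to see that the series converges exactly for growth index at least 5.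
The inequality u_n - p_2n(y) <= r^2 |Gamma|^2 (u_n - u_(n+1)) for words y of length 2r,
averaged over y, gives a Nash inequality and convergence when the volume is at least
c n^5. A tent function on a ball of radius of order sqrt n gives u_n >= c n^-2
when the volume is of order n^d with d <= 4. *)
Require Import Defs.
From mathcomp Require Import zify ring lra.
Set Implicit Arguments.
Unset Strict Implicit.
Unset Printing Implicit Defensive.
Import Order.TTheory GRing.Theory Num.Theory.
Local Open Scope classical_set_scope.
Local Open Scope ring_scope.

(** * Words in the generators and means over random words *)

Definition gprod (G : groupType) (s : seq G) : G := (\prod_(x <- s) x)%g.

Section GProd.
Variable G : groupType.
Implicit Types (s t : seq G) (x : G).

Lemma gprod_nil : gprod [::] = 1%g :> G.
Proof. by rewrite /gprod big_nil. Qed.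

Lemma gprod_cons x s : gprod (x :: s) = (x * gprod s)%g.
Proof. by rewrite /gprod big_cons. Qed.

Lemma gprod_cat s t : gprod (s ++ t) = (gprod s * gprod t)%g.
Proof. by rewrite /gprod big_cat. Qed.

Lemma gprod_rcons s x : gprod (rcons s x) = (gprod s * x)%g.
Proof. by rewrite -cats1 gprod_cat gprod_cons gprod_nil mulg1. Qed.

(** On the paths of the walk this is time reversal. *)
Definition inv_word s := rev [seq x^-1%g | x <- s].

Lemma gprod_inv_word s : gprod (inv_word s) = (gprod s)^-1%g.
Proof.
rewrite /inv_word; elim: s => [|x s IHs] /=; first by rewrite gprod_nil invg1.
by rewrite rev_cons gprod_rcons IHs gprod_cons invgM.
Qed.

Lemma size_inv_word s : size (inv_word s) = size s.
Proof. by rewrite /inv_word size_rev size_map. Qed.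

End GProd.

Section Words.
Variables (R : realType) (G : groupType) (Gam : {fset G}).
Hypothesis Gam0 : Gam != fset0.

Definition avg (f : G -> R) : R := (#|` Gam|%:R)^-1 * \sum_(x <- Gam) f x.

(** Expectation over n independent uniform letters. Events on finitely many steps are handled with
    this finite mean, which [P_steps] identifies with the law of the walk. *)
Fixpoint wmean (n : nat) (f : seq G -> R) : R :=
  if n is m.+1 then avg (fun x => wmean m (fun t => f (x :: t))) else f [::].

Definition word (n : nat) (s : seq G) := (size s == n) && all (mem Gam) s.

Lemma card_gt0 : 0 < #|` Gam|%:R :> R.
Proof. by rewrite ltr0n cardfs_gt0. Qed.

Lemma eq_avg f g : {in Gam, f =1 g} -> avg f = avg g.
Proof. by move=> fg; congr (_ * _); apply: eq_big_seq => x /fg. Qed.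

Lemma avgD f g : avg (fun x => f x + g x) = avg f + avg g.
Proof. by rewrite /avg big_split /= mulrDr. Qed.

Lemma avgZ c f : avg (fun x => c * f x) = c * avg f.
Proof. by rewrite /avg -mulr_sumr mulrCA. Qed.

Lemma avg_cst c : avg (fun=> c) = c.
Proof.
rewrite /avg big_const_seq count_predT iter_addr_0 -[c *+ _]mulr_natl mulrA.
by rewrite mulVf ?mul1r// gt_eqF // card_gt0.
Qed.

Lemma le_avg f g : {in Gam, forall x, f x <= g x} -> avg f <= avg g.
Proof.
move=> fg; rewrite ler_wpM2l ?invr_ge0 ?ler0n//.
by rewrite big_seq [leRHS]big_seq; apply: ler_sum.
Qed.

(** A single nonnegative term is at most the whole sum; this turns a bound on a mean over letters
    into a bound for each letter. *)
Lemma ler_avg f x : (forall y, y \in Gam -> 0 <= f y) -> x \in Gam ->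
  f x <= #|` Gam|%:R * avg f.
Proof.
move=> f0 xG; rewrite /avg mulrA divff ?gt_eqF ?card_gt0// mul1r.
rewrite (big_rem x xG) /= ler_wpDr// big_seq sumr_ge0// => y yG.
by rewrite f0// (mem_rem yG).
Qed.

Lemma eq_wmean n f g : (forall s, word n s -> f s = g s) -> wmean n f = wmean n g.
Proof.
elim: n f g => [|n IHn] f g fg /=; first exact: fg.
apply: eq_avg => x xG; apply: IHn => s /andP[sn sG].
by apply: fg; rewrite /word /= eqSS sn /= xG.
Qed.

Lemma le_wmean n f g : (forall s, word n s -> f s <= g s) -> wmean n f <= wmean n g.
Proof.
elim: n f g => [|n IHn] f g fg /=; first exact: fg.
apply: le_avg => x xG; apply: IHn => s /andP[sn sG].
by apply: fg; rewrite /word /= eqSS sn /= xG.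
Qed.

Lemma wmean_cst n c : wmean n (fun=> c) = c.
Proof. by elim: n => //= n ->; rewrite avg_cst. Qed.

Lemma wmeanD n f g : wmean n (fun s => f s + g s) = wmean n f + wmean n g.
Proof.
elim: n f g => //= n IHn f g; rewrite -avgD; apply: eq_avg => x _; exact: IHn.
Qed.

Lemma wmeanZ n c f : wmean n (fun s => c * f s) = c * wmean n f.
Proof.
elim: n f => //= n IHn f; rewrite -avgZ; apply: eq_avg => x _; exact: IHn.
Qed.

Lemma wmeanB n f g : wmean n (fun s => f s - g s) = wmean n f - wmean n g.
Proof.
rewrite wmeanD; congr (_ + _); rewrite -[RHS]mulN1r -wmeanZ.
by apply: eq_wmean => s _; rewrite mulN1r.
Qed.

Lemma wmean_sum n I (r : seq I) (P : pred I) (f : I -> seq G -> R) :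
  wmean n (fun s => \sum_(i <- r | P i) f i s) = \sum_(i <- r | P i) wmean n (f i).
Proof.
elim: r => [|i r IHr].
  under [LHS]eq_wmean do rewrite big_nil.
  by rewrite wmean_cst big_nil.
under [LHS]eq_wmean do rewrite big_cons.
by rewrite big_cons -IHr; case: ifP => // _; rewrite wmeanD.
Qed.

Lemma wmean_ge0 n f : (forall s, word n s -> 0 <= f s) -> 0 <= wmean n f.
Proof. by move=> f0; rewrite -(wmean_cst n 0); exact: le_wmean. Qed.

Lemma wmean_avg n (f : G -> seq G -> R) :
  wmean n (fun s => avg (f^~ s)) = avg (fun x => wmean n (f x)).
Proof. by rewrite /avg wmeanZ wmean_sum. Qed.

Lemma wmeanC n m f :
  wmean n (fun s => wmean m (f s)) = wmean m (fun t => wmean n (f^~ t)).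
Proof.
elim: n f => //= n IHn f; rewrite wmean_avg; apply: eq_avg => x _; exact: IHn.
Qed.

Lemma wmean_cat n m f :
  wmean (n + m) f = wmean n (fun s => wmean m (fun t => f (s ++ t))).
Proof. by elim: n f => //= n IHn f; apply: eq_avg => x _; rewrite IHn. Qed.

Lemma wmean_rcons n f :
  wmean n.+1 f = wmean n (fun s => avg (fun x => f (rcons s x))).
Proof. by rewrite -addn1 wmean_cat; apply: eq_wmean => s _ /=; under eq_avg do rewrite cats1. Qed.

Hypothesis Gam_sym : symmetric_fset Gam.

Lemma memV x : (x^-1%g \in Gam) = (x \in Gam).
Proof.
have H y : y \in Gam -> y^-1%g \in Gam.
  by move=> yG; rewrite -Gam_sym; apply/imfsetP; exists y.
by apply/idP/idP => [/H|/H//]; rewrite invgK.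
Qed.

Lemma avgV f : avg (fun x => f x^-1%g) = avg f.
Proof.
congr (_ * _); rewrite -(big_map (fun x : G => x^-1%g) xpredT f) /=.
apply: perm_big; apply: uniq_perm => //.
- by rewrite map_inj_uniq ?fset_uniq//; exact: invg_inj.
- exact: fset_uniq.
- move=> x; apply/mapP/idP => [[y yG ->]|xG]; first by rewrite memV.
  by exists x^-1%g; rewrite ?memV// invgK.
Qed.

(** Independent uniform letters keep their law when their order is reversed and, the alphabet being
    symmetric, when each is inverted. *)
Lemma wmean_inv_word n f : wmean n (fun s => f (inv_word s)) = wmean n f.
Proof.
elim: n f => //= n IHn f.
rewrite -[RHS]/(wmean n.+1 f) wmean_rcons -wmean_avg.
rewrite -[LHS]/(wmean n (fun t => avg (fun x => f (inv_word (x :: t))))).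
rewrite -[RHS]IHn; apply: eq_wmean => s _; rewrite -[RHS]avgV.
by apply: eq_avg => x _; rewrite /inv_word /= rev_cons.
Qed.

End Words.

Section WordSets.
Variables (G : groupType) (Gam : {fset G}).

(** Endpoints of words of length exactly n; these sets need not be nested, because of parity. *)
Fixpoint wordset (n : nat) : {fset G} :=
  if n is m.+1 then [fset (x * y)%g | x in Gam, y in wordset m]%fset
  else [fset 1%g]%fset.

Lemma wordsetP n g :
  reflect (exists2 s, word Gam n s & g = gprod s) (g \in wordset n).
Proof.
elim: n g => [|n IHn] g /=.
  rewrite inE; apply: (iffP eqP) => [->|[s /andP[/eqP/size0nil -> _] ->]].
    by exists [::]; rewrite ?gprod_nil.
  by rewrite gprod_nil.
apply: (iffP (imfset2P _ _ _ _ _)) => /= [[x xG [y /IHn[s /andP[sn sG] ->] ->]]|].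
  by exists (x :: s); rewrite ?gprod_cons// /word /= eqSS sn xG.
move=> [[|x s] /andP[//= sn /andP[xG sG]] ->]; exists x => //.
by exists (gprod s); rewrite ?gprod_cons//; apply/IHn; exists s => //; apply/andP.
Qed.

Lemma is_wordE n g : is_word Gam n g <-> g \in wordset n.
Proof.
split=> [[s [sG ->]]|/wordsetP[s /andP[sn sG] ->]].
  by apply/wordsetP; exists (tval s) => //; rewrite /word size_tuple eqxx.
by exists (Tuple sn).
Qed.

(** Countability makes every event on finitely many steps measurable, see [measurable_steps]. *)
Lemma generates_countable : generates Gam -> countable [set: G].
Proof.
move=> gen.
have -> : [set: G] = \bigcup_n [set` wordset n].
  apply/seteqP; split => // g _; have [n /is_wordE gn] := gen g.
  by exists n.
by apply: bigcup_countable => // n _; apply: finite_set_countable.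
Qed.

End WordSets.

(** * Heat kernel *)

Section FinSum.
Variables (R : realType) (K : choiceType).
Implicit Types (f g : K -> R).

Definition fsupp f := exists A : {fset K}, forall x, x \notin A -> f x = 0.

(** The sum has the default value 0 when the support is infinite, hence the [fsupp] hypotheses in
    the lemmas on additivity and comparison. *)
Definition fsum f : R := \sum_(x \in [set: K]) f x.

Lemma fsumE f (A : {fset K}) : (forall x, x \notin A -> f x = 0) ->
  fsum f = \sum_(x <- A) f x.
Proof. exact: fsbigTE. Qed.

Lemma fsuppD f g : fsupp f -> fsupp g -> fsupp (fun x => f x + g x).
Proof.
move=> [A fA] [B gB]; exists (A `|` B)%fset => x.
by rewrite inE negb_or => /andP[/fA -> /gB ->]; rewrite addr0.
Qed.

Lemma fsuppMl f g : fsupp f -> fsupp (fun x => f x * g x).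
Proof. by move=> [A fA]; exists A => x /fA ->; rewrite mul0r. Qed.

Lemma fsuppMr f g : fsupp g -> fsupp (fun x => f x * g x).
Proof. by move=> [A fA]; exists A => x /fA ->; rewrite mulr0. Qed.

Lemma fsupp_sum I (r : seq I) (F : I -> K -> R) : (forall i, fsupp (F i)) ->
  fsupp (fun x => \sum_(i <- r) F i x).
Proof.
move=> HF; elim: r => [|i r IHr].
  by exists fset0 => x _; rewrite big_nil.
have [A fA] := fsuppD (HF i) IHr; exists A => x /fA.
by rewrite big_cons.
Qed.

Lemma fsum_le f g : fsupp f -> fsupp g -> (forall x, f x <= g x) -> fsum f <= fsum g.
Proof.
move=> [A fA] [B gB] fg.
rewrite (@fsumE f (A `|` B)%fset) ?(@fsumE g (A `|` B)%fset); last 2 first.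
- by move=> x; rewrite inE negb_or => /andP[_ /gB].
- by move=> x; rewrite inE negb_or => /andP[/fA].
exact: ler_sum.
Qed.

Lemma fsum_ge0 f : (forall x, 0 <= f x) -> 0 <= fsum f.
Proof. by move=> f0; apply: fsumr_ge0. Qed.

Lemma fsumD f g : fsupp f -> fsupp g -> fsum (fun x => f x + g x) = fsum f + fsum g.
Proof.
move=> [A fA] [B gB].
rewrite (@fsumE f (A `|` B)%fset) ?(@fsumE g (A `|` B)%fset)
        ?(@fsumE _ (A `|` B)%fset) ?big_split //.
- by move=> x; rewrite inE negb_or => /andP[/fA -> /gB ->]; rewrite addr0.
- by move=> x; rewrite inE negb_or => /andP[_ /gB].
- by move=> x; rewrite inE negb_or => /andP[/fA].
Qed.

Lemma fsumZ c f : fsum (fun x => c * f x) = c * fsum f.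
Proof. by rewrite /fsum mulr_fsumr. Qed.

Lemma fsumN f : fsum (fun x => - f x) = - fsum f.
Proof. by rewrite -mulN1r -fsumZ; congr fsum; apply/funext => x; rewrite mulN1r. Qed.

Lemma fsum_sum I (r : seq I) (F : I -> K -> R) : (forall i, fsupp (F i)) ->
  fsum (fun x => \sum_(i <- r) F i x) = \sum_(i <- r) fsum (F i).
Proof.
move=> HF; elim: r => [|i r IHr].
  by rewrite (@fsumE _ fset0) ?big_nil// => x _; rewrite big_nil.
rewrite big_cons -IHr -fsumD//; last exact: fsupp_sum.
by congr fsum; apply/funext => x; rewrite big_cons.
Qed.

Lemma reindex_fsum f (h : K -> K) : bijective h -> fsum (f \o h) = fsum f.
Proof. by move=> hb; apply/esym; exact: reindex_fsbigT. Qed.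

Lemma fsum_delta f y : fsum (fun x => (x == y)%:R * f x) = f y.
Proof.
rewrite (@fsumE _ [fset y]%fset) => [|x]; last first.
  by rewrite inE => /negPf ->; rewrite mul0r.
by rewrite big_seq_fset1 eqxx mul1r.
Qed.

Lemma fsupp_delta y : fsupp (fun x => (x == y)%:R).
Proof. by exists [fset y]%fset => x; rewrite inE => /negPf ->. Qed.

Lemma fsupp_comp f (h k : K -> K) : cancel h k -> fsupp f -> fsupp (f \o h).
Proof.
move=> hk [A fA]; exists [fset k x | x in A]%fset => x xA /=; apply: fA.
apply: contra xA => hxA; apply/imfsetP; exists (h x) => //.
Qed.

End FinSum.

Lemma fsum_prod (R : realType) (K L : choiceType) (f : K -> R) (g : L -> R) :
  fsupp f -> fsupp g ->
  fsum (fun p : K * L => f p.1 * g p.2) = fsum f * fsum g.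
Proof.
move=> [A fA] [B gB]; rewrite (fsumE fA) (fsumE gB).
rewrite (@fsumE _ _ _ (A `*` B)%fset); last first.
  by move=> [x y]; rewrite inE negb_and => /orP[/fA|/gB] ->; rewrite ?mul0r ?mulr0.
transitivity (\sum_(p <- [seq (x, y) | x <- A, y <- B]) f p.1 * g p.2).
  apply: perm_big; apply: uniq_perm; first exact: fset_uniq.
    by apply: allpairs_uniq; [exact: fset_uniq|exact: fset_uniq|move=> [? ?] [? ?]].
  move=> [x y]; rewrite inE /=; apply/andP/allpairsP => [[xA yB]|[[x' y'] /= [xA yB [-> ->]]]//].
  by exists (x, y).
rewrite big_allpairs mulr_suml; apply: eq_bigr => x _.
by rewrite mulr_sumr.
Qed.

Section GroupFinSum.
Variables (R : realType) (G : groupType).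
Implicit Types (f g : G -> R).

Lemma fsupp_shift f y : fsupp f -> fsupp (fun x => f (x * y)%g).
Proof. by apply: (@fsupp_comp R G f _ (fun x => x * y^-1)%g) => x; rewrite mulgK. Qed.

Lemma fsum_mulr f y : fsum (fun x => f (x * y)%g) = fsum f.
Proof.
apply: (@reindex_fsum R G f (fun x => x * y)%g).
by exists (fun x => x * y^-1)%g => x; rewrite -mulgA ?mulgV ?mulVg mulg1.
Qed.

Lemma fsumV f : fsum (fun x => f x^-1%g) = fsum f.
Proof.
apply: (@reindex_fsum R G f (fun x => x^-1)%g).
by exists (fun x => x^-1)%g => x; rewrite invgK.
Qed.

End GroupFinSum.

(** * Markov operator, return probabilities and the pseudo-Poincare inequality *)

Section Heat.
Variables (R : realType) (G : groupType) (Gam : {fset G}).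
Hypothesis Gam0 : Gam != fset0.
Hypothesis Gam_sym : symmetric_fset Gam.
Implicit Types (f g : G -> R).
Local Notation avg := (@avg R G Gam).
Local Notation wmean := (@wmean R G Gam).

Definition mkv f x := avg (fun y => f (x * y)%g).

(** The probability that n steps lead from [x] to 1; by symmetry also the law at time n of the walk
    started at 1, see [heatE]. *)
Definition heat n : G -> R := iter n mkv (fun x => (x == 1%g)%:R).

Definition dot f g : R := fsum (fun x => f x * g x).

Lemma fsupp_mkv f : fsupp f -> fsupp (mkv f).
Proof. by move=> fs; apply/fsuppMr/fsupp_sum => y; exact: fsupp_shift. Qed.

Lemma fsupp_iter n f : fsupp f -> fsupp (iter n mkv f).
Proof. by move=> fs; elim: n => //= n; exact: fsupp_mkv. Qed.

Lemma fsupp_heat n : fsupp (heat n).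
Proof. exact/fsupp_iter/fsupp_delta. Qed.

Lemma fsum_avg (F : G -> G -> R) : (forall y, fsupp (F y)) ->
  fsum (fun x => avg (F^~ x)) = avg (fun y => fsum (F y)).
Proof. by move=> HF; rewrite fsumZ fsum_sum. Qed.

Lemma dotC f g : dot f g = dot g f.
Proof. by congr fsum; apply/funext => x; rewrite mulrC. Qed.

Lemma dot_mkvE f g : fsupp f ->
  dot (mkv f) g = avg (fun y => dot (fun x => f (x * y)%g) g).
Proof.
move=> fs; rewrite /dot /= -fsum_avg; last first.
  by move=> y; apply: fsuppMl; exact: fsupp_shift.
congr fsum; apply/funext => x; rewrite mulrC -avgZ.
by apply: eq_avg => y _; rewrite mulrC.
Qed.

(** Translation by [y] has translation by [y^-1] as its adjoint, and the mean over letters is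
    invariant under inversion. *)
Lemma dot_mkvl f g : fsupp f -> fsupp g -> dot (mkv f) g = dot f (mkv g).
Proof.
move=> fs gs; rewrite [RHS]dotC !dot_mkvE// -[LHS](avgV Gam_sym); apply: eq_avg => y _.
rewrite /dot -(fsum_mulr _ y); congr fsum; apply/funext => x.
by rewrite mulgK mulrC.
Qed.

Lemma dot_iterl n f g : fsupp f -> fsupp g ->
  dot (iter n mkv f) g = dot f (iter n mkv g).
Proof.
move=> fs; elim: n g => //= n IHn g gs; rewrite dot_mkvl//; last exact: fsupp_iter.
by rewrite IHn -?iterSr//; exact: fsupp_mkv.
Qed.

Lemma iter_mkvE n f x : iter n mkv f x = wmean n (fun t => f (x * gprod t)%g).
Proof.
elim: n x => [|n IHn] x /=; first by rewrite gprod_nil mulg1.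
apply: eq_avg => y _; rewrite IHn; apply: eq_wmean => s _.
by rewrite gprod_cons mulgA.
Qed.

Lemma heat_ge0 n x : 0 <= heat n x.
Proof. by rewrite /heat iter_mkvE wmean_ge0. Qed.

Lemma fsum_iter n f : fsupp f -> fsum (iter n mkv f) = fsum f.
Proof.
move=> fs; elim: n => //= n IHn; rewrite fsum_avg; last first.
  by move=> y; apply: fsupp_shift; exact: fsupp_iter.
by rewrite -[RHS](avg_cst Gam0); apply: eq_avg => y _; rewrite fsum_mulr IHn.
Qed.

Lemma fsum_heat n : fsum (heat n) = 1.
Proof.
rewrite fsum_iter; last exact: fsupp_delta.
transitivity (fsum (fun x : G => (x == 1%g)%:R * (1 : R))).
  by congr fsum; apply/funext => x; rewrite mulr1.
exact: (fsum_delta (fun=> 1)).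
Qed.

Lemma heatE n x : heat n x = wmean n (fun t => (gprod t == x)%:R).
Proof.
rewrite /heat iter_mkvE -(wmean_inv_word Gam0 Gam_sym); apply: eq_wmean => s _.
by rewrite gprod_inv_word divg_eq1 eq_sym.
Qed.

Lemma heatV n x : heat n x^-1%g = heat n x.
Proof.
rewrite !heatE -(wmean_inv_word Gam0 Gam_sym); apply: eq_wmean => s _.
by rewrite gprod_inv_word eqg_inv.
Qed.

Lemma iter_delta n z x : iter n mkv (fun y => (y == z)%:R) x = heat n (z^-1 * x)%g.
Proof.
rewrite /heat !iter_mkvE; apply: eq_wmean => s _.
by rewrite -mulgA mulg_eq1 eqg_inv eq_sym.
Qed.

(** Chapman-Kolmogorov: move m applications of the self-adjoint [mkv] onto the point mass at [z]. *)
Lemma heatD n m z : heat (n + m) z = dot (heat n) (fun x => heat m (z^-1 * x)%g).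
Proof.
rewrite -[LHS](fsum_delta (heat (n + m))) -/(dot _ _) dotC addnC /heat iterD.
rewrite dot_iterl; [|exact: fsupp_heat|exact: fsupp_delta].
congr dot; apply/funext => x; exact: iter_delta.
Qed.

Lemma heat_shift n z : heat (n + n) z = dot (heat n) (fun x => heat n (x * z)%g).
Proof.
rewrite heatD /dot -fsumV; congr fsum; apply/funext => x.
by rewrite heatV -invgM heatV.
Qed.

(* Only even times are used, to avoid parity problems. *)
Definition ret n : R := heat (n + n) 1%g.

Lemma retE n : ret n = dot (heat n) (heat n).
Proof. by rewrite /ret heat_shift; congr fsum; apply/funext => x; rewrite mulg1. Qed.

Lemma ret_ge0 n : 0 <= ret n. Proof. exact: heat_ge0. Qed.

Lemma dot_diff f z : fsupp f ->
  fsum (fun x => (f x - f (x * z)%g) ^+ 2) =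
  2 * (dot f f - dot f (fun x => f (x * z)%g)).
Proof.
move=> fs.
have -> : (fun x => (f x - f (x * z)%g) ^+ 2) = (fun x =>
   (f x * f x + f (x * z)%g * f (x * z)%g) + - (2 * (f x * f (x * z)%g))).
  by apply/funext => x; ring.
have fs' := fsupp_shift z fs.
rewrite fsumD ?fsumD ?fsumN ?fsumZ ?(fsum_mulr (fun x => f x * f x))/dot; first ring.
- exact: fsuppMl.
- exact: fsuppMl.
- by apply: fsuppD; exact: fsuppMl.
- rewrite [X in fsupp X](_ : _ = fun x => f x * (- 2 * f (x * z)%g)); first exact: fsuppMl.
  by apply/funext => x; ring.
Qed.

(** Dirichlet form of the two-step walk: by self-adjointness, the pairing of [f] with
    [f - mkv (mkv f)]. At [heat n] it equals [ret n - ret n.+1]. *)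
Definition dirichlet f := dot f f - dot (mkv f) (mkv f).

Lemma avg_diff f : fsupp f ->
  avg (fun y => avg (fun z => fsum (fun x => (f x - f (x * (y * z))%g) ^+ 2))) =
  2 * dirichlet f.
Proof.
move=> fs; rewrite /dirichlet dot_mkvl; [|exact: fs|exact: fsupp_mkv].
rewrite [dot f (mkv _)]dotC.
rewrite dot_mkvE; last exact: fsupp_mkv.
rewrite -[X in X - _](avg_cst Gam0) -[- avg _]mulN1r -avgZ -avgD -avgZ.
apply: eq_avg => y _; rewrite -[X in X + _](avg_cst Gam0).
have -> : dot (fun x => mkv f (x * y)%g) f =
    avg (fun z => dot f (fun x => f (x * (y * z))%g)).
  rewrite /dot -fsum_avg; last by move=> ?; exact: fsuppMl.
  congr fsum; apply/funext => x; rewrite mulrC -avgZ.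
  by apply: eq_avg => z _; rewrite mulgA.
rewrite -avgZ -avgD -avgZ; apply: eq_avg => z _.
by rewrite dot_diff// mulN1r.
Qed.

Lemma diff2_le f y z : fsupp f -> y \in Gam -> z \in Gam ->
  fsum (fun x => (f x - f (x * (y * z))%g) ^+ 2) <=
  #|` Gam|%:R ^+ 2 * (2 * dirichlet f).
Proof.
move=> fs yG zG; rewrite -avg_diff// expr2 -mulrA -avgZ.
pose F y z := fsum (fun x => (f x - f (x * (y * z))%g) ^+ 2).
have F0 a b : 0 <= F a b by apply: fsum_ge0 => x; exact: sqr_ge0.
apply: (@le_trans _ _ (#|` Gam|%:R * avg (F y))); first by apply: (ler_avg Gam0) => // b _.
apply: (ler_avg Gam0 (f := fun y => #|` Gam|%:R * avg (F y))) => // a aG.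
by rewrite mulr_ge0// -(avg_cst Gam0 0); apply: le_avg.
Qed.

(* The step is (a + b)^2 <= (1 + 1/r) a^2 + (1 + r) b^2. *)
Lemma diff_word_le f r s : fsupp f -> word Gam (r.*2) s ->
  fsum (fun x => (f x - f (x * gprod s)%g) ^+ 2) <=
  r%:R ^+ 2 * (#|` Gam|%:R ^+ 2 * (2 * dirichlet f)).
Proof.
move=> fs; elim: r s => [|r IHr] s.
  rewrite /word size_eq0 => /andP[/eqP-> _].
  rewrite expr0n mul0r (@fsumE _ _ _ fset0) ?big_nil// => x _.
  by rewrite gprod_nil mulg1 subrr expr0n.
case: s => [|y [|z s]]; rewrite /word ?doubleS //= !eqSS.
set D := (_ * (2 * _)) in IHr *.
move=> /andP[ss /and3P[yG zG sG]]; rewrite 2!gprod_cons.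
have := diff2_le fs yG zG; rewrite -/D => D2.
(* The weight 1/r needs r nonzero; for r = 0 the remaining word is empty and the two-letter bound
   suffices. *)
have [r0|r0] := eqVneq r 0%N.
  by move: ss; rewrite r0 size_eq0 => /eqP ->; rewrite gprod_nil mulg1 expr1n mul1r.
have {IHr}/(_ _)/= := IHr s; rewrite /word ss sG => /(_ isT) IH.
have r1 : 0 < r%:R :> R by rewrite ltr0n lt0n.
rewrite -(ler_pM2l r1).
apply: (@le_trans _ _ (r%:R * (r%:R + 1) * D + (r%:R + 1) * (r%:R ^+ 2 * D))); last first.
  by rewrite -[in r.+1%:R]addn1 natrD le_eqVlt; apply/orP; left; apply/eqP; ring.
apply: (@le_trans _ _ (
  r%:R * (r%:R + 1) * fsum (fun x => (f x - f (x * (y * z))%g) ^+ 2) +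
  (r%:R + 1) * fsum (fun x => (f x - f (x * gprod s)%g) ^+ 2))); last first.
  by rewrite lerD// ler_wpM2l ?mulr_ge0 ?addr_ge0 // ltW.
rewrite -[X in _ + (_ * X)](fsum_mulr _ (y * z)%g) -!fsumZ.
have f2 u : fsupp (fun x => (f x - f (x * u)%g) ^+ 2).
  have [A fA] := fsuppD fs (fsuppMr (fun=> -1) (fsupp_shift u fs)).
  by exists A => x /fA; rewrite mulN1r => ->; rewrite expr0n.
rewrite -fsumD; last 2 first.
- by apply: fsuppMr.
- by apply: fsuppMr; apply: (fsupp_shift _ (f2 _)).
apply: fsum_le => [||x]; first by apply: fsuppMr.
  by apply: fsuppD; apply: fsuppMr => //; apply: (fsupp_shift _ (f2 _)).
rewrite !mulgA; set a := f x; set b := f _; set c := f _.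
(* This square is exactly the difference of the two sides. *)
have := sqr_ge0 (r%:R * (a - c) - (c - b)); nra.
Qed.

(* Pseudo-Poincare inequality for the heat kernel. *)
Lemma ret_shift_le n r s : word Gam (r.*2) s ->
  ret n - heat (n + n) (gprod s) <= r%:R ^+ 2 * #|` Gam|%:R ^+ 2 * (ret n - ret n.+1).
Proof.
move=> sw; have fh := fsupp_heat n.
have := diff_word_le fh sw; rewrite dot_diff// -heat_shift -retE.
rewrite /dirichlet -[mkv (heat n)]/(heat n.+1) -!retE; nra.
Qed.

(** Half the squared distance between [heat n] and its translate by [z] is
    [ret n - heat (n + n) z]. *)
Lemma ret_max n z : heat (n + n) z <= ret n.
Proof.
have := dot_diff z (fsupp_heat n); rewrite -heat_shift -retE => H.
suff : 0 <= 2 * (ret n - heat (n + n) z) by lra.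
by rewrite -H; apply: fsum_ge0 => x; exact: sqr_ge0.
Qed.

Lemma dirichlet_ge0 f : fsupp f -> 0 <= dirichlet f.
Proof.
move=> fs; suff : 0 <= 2 * dirichlet f by lra.
rewrite -avg_diff// -(avg_cst Gam0 0); apply: le_avg => y _.
rewrite -(avg_cst Gam0 0); apply: le_avg => z _.
by apply: fsum_ge0 => x; exact: sqr_ge0.
Qed.

Lemma ret_decr n : ret n.+1 <= ret n.
Proof. by have := dirichlet_ge0 (fsupp_heat n);
  rewrite /dirichlet -[mkv (heat n)]/(heat n.+1) -!retE; lra. Qed.

End Heat.

(** * Capacity of finite sets *)

(** Compares asymptotic slopes: a bounded error disappears on division by k. *)
Lemma archi_le (R : realType) (x y d : R) :
  (forall k : nat, k%:R * x <= k%:R * y + d) -> x <= y.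
Proof.
move=> H; rewrite leNgt; apply/negP => yx.
have [k kP] : exists k : nat, d / (x - y) < k%:R.
  exists (Num.bound `|d / (x - y)|).
  exact: le_lt_trans (ler_norm _) (archi_boundP (normr_ge0 _)).
have xy0 : 0 < x - y by lra.
move: kP; rewrite ltr_pdivrMr//; move: (H k); lra.
Qed.

Section Trace.
Variable G : groupType.
Implicit Types (s t : seq G) (A B : {fset G}).

Definition trace t : {fset G} :=
  [fset x in [seq gprod (take k t) | k <- iota 0 (size t).+1]]%fset.

Lemma traceP t x :
  reflect (exists2 k, (k <= size t)%N & x = gprod (take k t)) (x \in trace t).
Proof.
rewrite in_fset; apply: (iffP mapP) => [[k kt ->]|[k kt ->]].
  by exists k => //; move: kt; rewrite mem_iota.
by exists k => //; rewrite mem_iota.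
Qed.

(** The starting points from which the walk with steps [t] meets [A] by time [size t]. *)
Definition hit A t : {fset G} := [fset (a * x^-1)%g | a in A, x in trace t]%fset.

Lemma hitP A t y :
  reflect (exists a k, [/\ a \in A, (k <= size t)%N & y = (a * (gprod (take k t))^-1)%g])
          (y \in hit A t).
Proof.
apply: (iffP (imfset2P _ _ _ _ _)) => /= [[a aA [x /traceP[k kt ->] ->]]|].
  by exists a, k.
move=> [a [k [aA kt ->]]]; exists a => //; exists (gprod (take k t)) => //.
by apply/traceP; exists k.
Qed.

Lemma hitU A B t : hit (A `|` B)%fset t = (hit A t `|` hit B t)%fset.
Proof.
apply/fsetP => y; rewrite inE; apply/hitP/orP => [[a [k [+ kt ->]]]|].
  by rewrite inE => /orP[aA|aB]; [left|right]; apply/hitP; exists a, k.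
by move=> [] /hitP[a [k [aA kt ->]]]; exists a, k; split => //; rewrite inE aA ?orbT.
Qed.

Lemma hitS A B t : (A `<=` B)%fset -> (hit A t `<=` hit B t)%fset.
Proof. by move=> /fsetUidPr <-; rewrite hitU; exact: fsubsetUl. Qed.

(** Time 0 is excluded, as in the positive return time. *)
Definition escapes A g t : bool :=
  all (fun k => (g * gprod (take k t))%g \notin A) (iota 1 (size t)).

Lemma escapesP A g t :
  reflect (forall k, (0 < k <= size t)%N -> (g * gprod (take k t))%g \notin A)
          (escapes A g t).
Proof.
apply: (iffP allP) => H k; have := H k; rewrite mem_iota add1n ltnS; exact.
Qed.

Lemma escapes_rcons A g t x : escapes A g (rcons t x) -> escapes A g t.
Proof.
move=> /escapesP H; apply/escapesP => k /andP[k0 kt].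
have := H k; rewrite size_rcons k0 (leq_trans kt)//= => /(_ isT).
by rewrite -cats1 takel_cat.
Qed.

Lemma hit_rcons A t x : hit A (rcons t x) =
  (hit A t `|` [fset a * (gprod (rcons t x))^-1 | a in A]%g)%fset.
Proof.
apply/fsetP => y; rewrite inE; apply/hitP/orP => [[a [k [aA]]]|].
  rewrite size_rcons leq_eqVlt => /orP[/eqP -> ->|kt ->]; [right|left].
    by apply/imfsetP; exists a => //=; rewrite take_oversize ?size_rcons.
  by apply/hitP; exists a, k; split => //; rewrite -cats1 takel_cat.
case=> [/hitP[a [k [aA kt ->]]]|/imfsetP[a /= aA ->]].
  by exists a, k; rewrite -cats1 takel_cat// size_cat addn1 leqW.
by exists a, (size (rcons t x)); rewrite take_size.
Qed.

Lemma take_inv_word k t : (k <= size t)%N ->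
  gprod (take k (inv_word t)) = ((gprod t)^-1 * gprod (take (size t - k) t))%g.
Proof.
move=> kt; rewrite -{2}(cat_take_drop (size t - k) t) gprod_cat invgM.
rewrite -mulgA mulVg mulg1 -gprod_inv_word; congr gprod.
by rewrite /inv_word take_rev size_map map_drop.
Qed.

(* Reading the walk backwards from its last step turns first visits into escapes. *)
Lemma card_hit_rcons A t x : #|` hit A (rcons t x)| =
  (#|` hit A t| + count (fun g => escapes A g (inv_word (rcons t x))) A)%N.
Proof.
rewrite hit_rcons; set p := gprod (rcons t x).
(* If the reversed walk from [a] returns to [A], then the walk from [a * p^-1] met [A] before its
   last step, so [a] adds nothing new. *)
have -> : (hit A t `|` [fset a * p^-1 | a in A]%g)%fset =
  (hit A t `|` [fset a * p^-1 | a in [fset a in A | escapes A a (inv_word (rcons t x))]]%g)%fset.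
  apply/fsetP => y; rewrite !inE; case: (boolP (y \in hit A t)) => //= yA.
  apply/imfsetP/imfsetP => [][a /= aA yE]; exists a => //=; last first.
    by move: aA; rewrite !inE => /andP[].
  rewrite yE in yA; rewrite !inE aA /=; apply/escapesP => k; rewrite size_inv_word => /andP[k0 kt].
  rewrite take_inv_word// -/p; apply: contra yA => yA.
  apply/hitP; exists (a * (p^-1 * gprod (take (size (rcons t x) - k) (rcons t x))))%g.
  have st : (size (rcons t x) - k <= size t)%N by rewrite size_rcons; lia.
  exists (size (rcons t x) - k)%N; split => //.
  by rewrite -[X in take _ X]cats1 takel_cat// mulgA mulgK.
rewrite -[LHS]addn0 -[in LHS](@cardfs0 G).
(* The remaining points are disjoint from [hit A t], so the cardinalities add. *)
have /eqP <- : ((hit A t `&` [fset a * p^-1 | a in [fset a in A | escapes A a (inv_word (rcons t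
  x))]]%g)%fset == fset0).
  rewrite -fsubset0; apply/fsubsetP => y; rewrite inE => /andP[/hitP[b [k [bA kt ->]]]].
  move=> /imfsetP[a /=]; rewrite !inE => /andP[aA /escapesP H] E.
  have := H ((size t).+1 - k)%N; rewrite size_inv_word size_rcons.
  rewrite take_inv_word ?size_rcons; last lia.
  rewrite -/p mulgA -E -cats1 takel_cat; last lia.
  rewrite subKn; last lia.
  rewrite mulgVK bA => H1; suff : false by [].
  apply: H1; lia.
rewrite cardfsUI card_imfset ?size_filter//=; last by move=> ? ? /mulIg.
congr (_ + _)%N; rewrite -size_filter; apply: perm_size; apply: uniq_perm.
- exact: fset_uniq.
- by rewrite filter_uniq// fset_uniq.
- by move=> a; rewrite !inE mem_filter andbC.
Qed.

Lemma trace_cat s t :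
  trace (s ++ t) = (trace s `|` [fset gprod s * x | x in trace t]%g)%fset.
Proof.
apply/fsetP => y; rewrite inE; apply/traceP/orP => [[k]|].
  rewrite size_cat => kst ->; have [ks|ks] := leqP k (size s); [left|right].
    by apply/traceP; exists k => //; rewrite takel_cat.
  apply/imfsetP; exists (gprod (take (k - size s) t)) => /=.
    by apply/traceP; exists (k - size s)%N => //; lia.
  by rewrite take_cat ltnNge (ltnW ks)/= gprod_cat.
move=> [/traceP[k ks ->]|/imfsetP[x /= /traceP[k kt ->] ->]].
  by exists k; rewrite ?size_cat ?takel_cat//; lia.
exists (size s + k)%N; rewrite ?size_cat ?leq_add2l//.
by rewrite take_cat ltnNge leq_addr/= addKn gprod_cat.
Qed.

End Trace.

Section Capacity.
Variables (R : realType) (G : groupType) (Gam : {fset G}).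
Hypothesis Gam0 : Gam != fset0.
Hypothesis Gam_sym : symmetric_fset Gam.
Implicit Types (A B : {fset G}).
Local Notation wmean := (@wmean R G Gam).

Definition esc n A g : R := wmean n (fun t => (escapes A g t)%:R).
Definition capn n A : R := \sum_(g <- A) esc n A g.
Definition cap A : R := limn (capn^~ A).
Definition wsize n A : R := wmean n (fun t => #|` hit A t|%:R).

Lemma esc_ge0 n A g : 0 <= esc n A g.
Proof. by apply: wmean_ge0 => // s _; rewrite ler0n. Qed.

Lemma escS n A g : esc n.+1 A g <= esc n A g.
Proof.
rewrite /esc wmean_rcons//; apply: le_wmean => t _.
rewrite -[leRHS](avg_cst Gam0); apply: le_avg => x _.
by rewrite ler_nat; case: (boolP (escapes _ _ (rcons _ _))) => // /escapes_rcons ->.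
Qed.

Lemma capn_ge0 n A : 0 <= capn n A.
Proof. by apply: sumr_ge0 => g _; exact: esc_ge0. Qed.

Lemma capn_noninc A : nonincreasing_seq (capn^~ A).
Proof.
apply/nonincreasing_seqP => n; apply: ler_sum => g _; exact: escS.
Qed.

Lemma cvg_esc A g : cvgn (fun n => esc n A g).
Proof.
apply: nonincreasing_is_cvgn; first by apply/nonincreasing_seqP => n; exact: escS.
by exists 0 => _ [n _ <-]; exact: esc_ge0.
Qed.

Lemma cvg_capn A : cvgn (capn^~ A).
Proof.
apply: nonincreasing_is_cvgn; first exact: capn_noninc.
by exists 0 => _ [n _ <-]; exact: capn_ge0.
Qed.

Lemma cap_le_capn n A : cap A <= capn n A.
Proof. exact: nonincreasing_cvgn_ge (@capn_noninc A) (cvg_capn (A:=A)) n. Qed.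

Lemma cap_ge0 A : 0 <= cap A.
Proof. by apply: limr_ge; [exact: cvg_capn|apply: nearW => n; exact: capn_ge0]. Qed.

(** Take means in [card_hit_rcons]; invariance under time reversal removes [inv_word]. *)
Lemma wsizeS n A : wsize n.+1 A = wsize n A + capn n.+1 A.
Proof.
rewrite /capn /esc -wmean_sum// -[X in _ + X](wmean_inv_word Gam0 Gam_sym).
rewrite /wsize !wmean_rcons// -wmeanD; apply: eq_wmean => s _.
rewrite -[X in X + _](avg_cst Gam0) -avgD; apply: eq_avg => x _.
by rewrite card_hit_rcons natrD -sum1_count big_mkcond natr_sum.
Qed.

(** Every increment of [wsize] is at least [cap A]. With [wsize_le], which bounds late increments by
    [capn m A], this makes [cap A] the asymptotic slope of [wsize]. *)
Lemma wsize_ge n A : n%:R * cap A <= wsize n A.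
Proof.
elim: n => [|n IHn]; first by rewrite mul0r; apply: wmean_ge0 => // t _; rewrite ler0n.
by rewrite wsizeS -addn1 natrD mulrDl mul1r lerD// cap_le_capn.
Qed.

Lemma wsize_le m k A : wsize (m + k) A <= wsize m A + k%:R * capn m A.
Proof.
elim: k => [|k IHk]; first by rewrite addn0 mul0r addr0.
rewrite addnS wsizeS -[in k.+1%:R]addn1 natrD mulrDl mul1r addrA lerD//.
by apply: capn_noninc; rewrite -addnS leq_addr.
Qed.

Lemma le_wsize n A B : (A `<=` B)%fset -> wsize n A <= wsize n B.
Proof.
by move=> AB; apply: le_wmean => t _; rewrite ler_nat fsubset_leq_card// hitS.
Qed.

(** Compare the slopes of [wsize], which is monotone in the set since [hit] is. *)
Lemma le_cap A B : (A `<=` B)%fset -> cap A <= cap B.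
Proof.
move=> AB; apply: limr_ge; [exact: cvg_capn|apply: nearW => m].
apply: (@archi_le _ _ _ (wsize m B)) => k.
rewrite addrC; apply: le_trans (wsize_le _ _ _).
apply: le_trans (le_wsize _ AB); apply: le_trans (wsize_ge _ _).
by rewrite natrD mulrDl ler_wpDl// mulr_ge0// cap_ge0.
Qed.

(** Again a comparison of slopes, now from the union bound for the cardinality of [hit]. *)
Lemma capU A B : cap (A `|` B)%fset <= cap A + cap B.
Proof.
rewrite -limD; [|exact: cvg_capn..].
apply: limr_ge; [by apply: is_cvgD; exact: cvg_capn|apply: nearW => m].
apply: (@archi_le _ _ _ (wsize m A + wsize m B)) => k.
rewrite mulrDr addrC addrACA.
apply: le_trans (lerD (wsize_le _ _ _) (wsize_le _ _ _)).
apply: (@le_trans _ _ (wsize (m + k) (A `|` B)%fset)).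
  apply: le_trans (wsize_ge _ _).
  by rewrite natrD mulrDl ler_wpDl// mulr_ge0// cap_ge0.
rewrite -wmeanD//; apply: le_wmean => t _.
by rewrite hitU -natrD ler_nat cardfsU leq_subr.
Qed.

Lemma cap_mull (g : G) A : cap [fset g * a | a in A]%g%fset = cap A.
Proof.
congr (limn _); apply/funext => n; rewrite /capn big_imfset/=; last first.
  by move=> ? ? _ _ /mulgI.
apply: eq_bigr => a _; apply: eq_wmean => t _; congr (_%:R).
congr nat_of_bool; apply: eq_all => k.
rewrite -mulgA; congr (~~ _); apply/imfsetP/idP => [[b /= bA /mulgI -> //]|aA].
by exists (a * gprod (take k t))%g.
Qed.

Definition capw (t : seq G) : R := cap (trace t).

Lemma capw_ge0 t : 0 <= capw t. Proof. exact: cap_ge0. Qed.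

Lemma capw_cat s t : capw (s ++ t) <= capw s + capw t.
Proof. by rewrite /capw trace_cat (le_trans (capU _ _))// cap_mull. Qed.

Lemma capw_catl s t : capw s <= capw (s ++ t).
Proof. by apply: le_cap; rewrite trace_cat fsubsetUl. Qed.

Lemma cvg_wmean n (f : nat -> seq G -> R) (g : seq G -> R) :
  (forall s, (fun k => f k s) @ \oo --> g s) ->
  (fun k => wmean n (f k)) @ \oo --> wmean n g.
Proof.
elim: n f g => [|n IHn] f g fg /=; first exact: fg.
apply: cvgMr; apply: cvg_big => [|x _]; last exact: IHn.
exact: add_continuous.
Qed.

Definition mcap n : R := wmean n capw.

(* The mean number of distinct S_i T_j^-1 for i <= n and j <= k. *)
Definition mhit n k : R := wmean n (fun s => wsize k (trace s)).

(** With [mcap_ge], this reads the mean capacity off the slope of [mhit] in k, for n fixed. *)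
Lemma mcap_le n c d : (forall k, mhit n k <= k%:R * c + d) -> mcap n <= c.
Proof.
move=> H; apply: (@archi_le _ _ _ d) => k; apply: le_trans (H k).
by rewrite /mcap -wmeanZ//; apply: le_wmean => s _; exact: wsize_ge.
Qed.

Lemma mcap_ge n c d : (forall k, k%:R * c <= mhit n k + d) -> c <= mcap n.
Proof.
move=> H; have cvgm : (fun k => wmean n (fun s => capn k (trace s))) @ \oo --> mcap n.
  apply: cvg_wmean => s; exact: cvg_capn.
rewrite -(cvg_lim _ cvgm)//; apply: limr_ge; first by apply/cvg_ex; exists (mcap n).
apply: nearW => m; apply: (@archi_le _ _ _ (mhit n m + d - m%:R * c)) => k.
have := H (m + k)%N; rewrite natrD mulrDl.
have : mhit n (m + k) <= mhit n m + k%:R * wmean n (fun s => capn m (trace s)).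
  rewrite -wmeanZ// -wmeanD//; apply: le_wmean => s _; exact: wsize_le.
lra.
Qed.

End Capacity.

(** * Subadditivity and almost sure convergence *)

Section Subadditive.
Variables (R : realType) (c : nat -> R).
Hypothesis c_ge0 : forall n, 0 <= c n.
Hypothesis c_sub : forall n m, c (n + m)%N <= c n + c m.

(** The limit in Fekete's lemma; the shift avoids the index 0. *)
Definition growth_rate : R := inf (range (fun n => c n.+1 / n.+1%:R)).

Lemma growth_rate_le n : (0 < n)%N -> growth_rate <= c n / n%:R.
Proof.
case: n => // n _; apply: ge_inf; last by exists n.
by exists 0 => _ [k _ <-]; rewrite divr_ge0// ler0n.
Qed.

Lemma growth_rate_ge (b : R) : (forall n, (0 < n)%N -> b <= c n / n%:R) ->
  b <= growth_rate.
Proof.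
move=> H; apply: lb_le_inf; first by exists (c 1 / 1%:R), 0%N.
by move=> _ [k _ <-]; exact: H.
Qed.

Lemma growth_rate_ge0 : 0 <= growth_rate.
Proof. by apply: growth_rate_ge => n _; rewrite divr_ge0// ler0n. Qed.

(** Fekete's lemma: divide n by a length at which the infimum is almost attained. *)
Lemma cvg_growth_rate (e : R) : 0 < e ->
  exists N, forall n, (N <= n)%N -> c n / n%:R <= growth_rate + e.
Proof.
move=> e0; have e20 : 0 < e / 2 by lra.
have hi : has_inf (range (fun n => c n.+1 / n.+1%:R)).
  split; first by exists (c 1 / 1%:R), 0%N.
  by exists 0 => _ [k _ <-]; rewrite divr_ge0// ler0n.
have [_ [m _ <-] hm] := inf_adherent e20 hi; rewrite -/growth_rate in hm.
set a := c m.+1 / _ in hm.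
(* An upper bound for [c] at every possible remainder. *)
pose M := \sum_(r < m.+1) c r.
have cq q : c (q * m.+1)%N <= (q * m.+1)%:R * a + c 0%N.
  elim: q => [|q IHq]; first by rewrite mul0n mul0r add0r.
  rewrite mulSn natrD mulrDl -addrA; apply: le_trans (c_sub _ _) _; rewrite lerD//.
  by rewrite /a mulrCA divff ?mulr1// pnatr_eq0.
have [N NP] : exists N : nat, (c 0%N + M) / (e / 2) < N%:R.
  exists (Num.bound `|(c 0%N + M) / (e / 2)|).
  exact: le_lt_trans (ler_norm _) (archi_boundP (normr_ge0 _)).
exists N.+1 => n nN; have n0 : 0 < n%:R :> R by rewrite ltr0n (leq_trans _ nN).
rewrite ler_pdivrMr//.
have a0 : 0 <= a by rewrite divr_ge0// ler0n.
have : c n <= n%:R * a + (c 0%N + M).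
  rewrite {1}(divn_eq n m.+1); apply: le_trans (c_sub _ _) _.
  rewrite addrA lerD//; last first.
    have rm : (n %% m.+1 < m.+1)%N by rewrite ltn_mod.
    rewrite /M (bigD1 (Ordinal rm))//= ler_wpDr// sumr_ge0//.
  apply: le_trans (cq _) _; rewrite lerD2r ler_wpM2r// ler_nat.
  exact: leq_trunc_div.
move/le_trans; apply.
have nN' : N%:R <= n%:R :> R by rewrite ler_nat ltnW.
rewrite ltr_pdivrMr// in NP.
have : c 0%N + M <= n%:R * (e / 2).
  by apply: le_trans (ltW NP) _; rewrite ler_pM2r.
have : n%:R * a <= n%:R * (growth_rate + e / 2) by rewrite ler_pM2l// ltW.
lra.
Qed.

End Subadditive.

Section DyadicFilling.
Variables (R : realType) (C : nat -> R) (mu : R).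
Hypothesis C_ge0 : forall n, 0 <= C n.
Hypothesis C_nondec : {homo C : n m / (n <= m)%N >-> n <= m}.
Hypothesis C_dyadic : forall m, (0 < m)%N ->
  (fun k => C (m * 2 ^ k)%N / (m * 2 ^ k)%:R) @ \oo --> mu.

(** Sandwich n between m 2^k and (m+1) 2^k with m large but bounded: monotonicity of [C] then costs
    only a factor close to 1. *)
Lemma cvg_dyadic_filling : (fun n => C n / n%:R) @ \oo --> mu.
Proof.
have mu0 : 0 <= mu.
  have /cvg_lim <- // := C_dyadic (ltn0Sn 0).
  apply: limr_ge; first by apply/cvg_ex; exists mu; exact: C_dyadic.
  by apply: nearW => k; rewrite divr_ge0// ler0n.
apply/cvgrPdist_le => e e0.
pose d := Num.min (e / 2) 1; have d0 : 0 < d by rewrite lt_min ltr01 andbT; lra.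
have de : d <= e / 2 by rewrite ge_min lexx.
have d1 : d <= 1 by rewrite ge_min lexx orbT.
(* For m at least M, the error (mu + 1) / m from passing to m + 1 is at most e / 2. *)
have [M' M'P] : exists M : nat, (mu + 1) / (e / 2) < M%:R.
  exists (Num.bound `|(mu + 1) / (e / 2)|).
  exact: le_lt_trans (ler_norm _) (archi_boundP (normr_ge0 _)).
pose M := M'.+1; have M0 : 0 < M%:R :> R by rewrite ltr0n.
have MP : mu + 1 <= M%:R * (e / 2).
  rewrite ltr_pdivrMr in M'P; last lra.
  apply: le_trans (ltW M'P) _; rewrite ler_wpM2r//; first lra.
  by rewrite ler_nat.
(* Only finitely many m occur, so one threshold serves them all. *)
have [K KP] : exists K, forall k m, (K <= k)%N -> (0 < m)%N -> (m <= M.*2)%N ->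
    `|mu - C (m * 2 ^ k)%N / (m * 2 ^ k)%:R| <= d.
  elim: (M.*2) => [|L [K KP]]; first by exists 0%N => k m _; case: m.
  have /cvgrPdist_le /(_ _ d0) [K' _ K'P] := C_dyadic (ltn0Sn L).
  exists (maxn K K') => k m; rewrite geq_max => /andP[Kk K'k] m0.
  by rewrite leq_eqVlt => /orP[/eqP ->|]; [exact: K'P|exact: KP].
exists (M * 2 ^ K)%N => // n /= nM.
(* This k puts the quotient of n by 2^k into the window from M to 2M. *)
pose k := trunc_log 2 (n %/ M).
have nM0 : (0 < n %/ M)%N by rewrite divn_gt0// (leq_trans _ nM)// leq_pmulr// expn_gt0.
have k1 : (2 ^ k <= n %/ M)%N by exact: trunc_logP.
have k2 : (n %/ M < 2 ^ k.+1)%N by exact: trunc_log_ltn.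
have Kk : (K <= k)%N.
  rewrite -(@trunc_expnK 2 K)// leq_trunc_log// leq_divRL// mulnC//.
pose m := (n %/ 2 ^ k)%N; have p2 : (0 < 2 ^ k)%N by rewrite expn_gt0.
have mM : (M <= m)%N by rewrite leq_divRL// mulnC -leq_divRL.
have m2M : (m < M.*2)%N.
  by rewrite ltn_divLR// -mul2n -mulnA mulnCA -expnS mulnC -ltn_divLR.
have n1 : (m * 2 ^ k <= n)%N by exact: leq_trunc_div.
have n2 : (n <= m.+1 * 2 ^ k)%N by rewrite ltnW// ltn_ceil.
have m0 : (0 < m)%N by exact: leq_trans mM.
have := KP k m Kk m0 (ltnW m2M); have := KP k m.+1 Kk isT m2M.
move/C_nondec : n1 (n1) => c1; move/C_nondec : n2 (n2) => c2.
rewrite -(ler_nat R) => + ; rewrite -(ler_nat R).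
set p := (2 ^ k)%N in p2 c1 c2 *; rewrite !natrM.
have q0 : 0 < p%:R :> R by rewrite ltr0n.
have mr0 : 0 < m%:R :> R by rewrite ltr0n.
have mMr : M%:R <= m%:R :> R by rewrite ler_nat.
set x := C (m * p)%N in c1 *; set y := C (m.+1 * p)%N in c2 *.
rewrite -[in m.+1%:R]addn1 natrD.
set mr := m%:R in mr0 mMr *; set q := p%:R in q0 *; set nr := n%:R.
move=> n2 n1 Hy Hx.
have x_le : (mu - d) * (mr * q) <= x.
  have : mu - d <= x / (mr * q) by move: Hx; rewrite ler_norml; lra.
  by rewrite ler_pdivlMr// mulr_gt0.
have y_le : y <= (mu + d) * ((mr + 1) * q).
  have : y / ((mr + 1) * q) <= mu + d by move: Hy; rewrite ler_norml; lra.
  by rewrite ler_pdivrMr// mulr_gt0//; lra.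
have nr0 : 0 < nr by apply: lt_le_trans n1; rewrite mulr_gt0.
have H1 : (mu + 1) * q <= (e / 2) * (mr * q).
  rewrite mulrA ler_pM2r//; apply: le_trans MP _; rewrite mulrC ler_pM2l//; lra.
rewrite ler_norml; apply/andP; split.
  rewrite lerBrDl -lerBrDr opprK ler_pdivrMr//; apply: le_trans c2 _; apply: le_trans y_le _.
  apply: (@le_trans _ _ ((mu + e) * (mr * q))); last by rewrite ler_wpM2l//; lra.
  have : d * (mr * q) <= (e / 2) * (mr * q) by rewrite ler_wpM2r// mulr_ge0// ltW.
  have : d * q <= 1 * q by rewrite ler_wpM2r// ltW.
  nra.
rewrite lerBlDr -lerBlDl ler_pdivlMr//.
have [mue|mue] := leP (mu - e) 0; first by apply: le_trans (C_ge0 _); rewrite mulr_le0_ge0// ltW.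
apply: le_trans c1; apply: le_trans x_le.
apply: (@le_trans _ _ ((mu - e) * ((mr + 1) * q))); first by rewrite ler_wpM2l// ltW.
have : d * (mr * q) <= (e / 2) * (mr * q) by rewrite ler_wpM2r// mulr_ge0// ltW.
have : e * q > 0 by rewrite mulr_gt0.
nra.
Qed.

End DyadicFilling.

(** * Variance of the capacity along dyadic multiples *)

Section Variance.
Variables (R : realType) (G : groupType) (Gam : {fset G}).
Hypothesis Gam0 : Gam != fset0.
Hypothesis Gam_sym : symmetric_fset Gam.
Local Notation wmean := (@wmean R G Gam).
Local Notation capw := (@capw R G Gam).
Local Notation mcap := (@mcap R G Gam).

Lemma mcap_ge0 n : 0 <= mcap n.
Proof. by apply: wmean_ge0 => // s _; exact: capw_ge0. Qed.

Lemma mcap_sub n m : mcap (n + m) <= mcap n + mcap m.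
Proof.
rewrite /mcap wmean_cat -[X in _ <= _ + X](wmean_cst Gam0 n) -wmeanD.
apply: le_wmean => s _; rewrite -[X in _ <= X + _](wmean_cst Gam0 m) -wmeanD.
by apply: le_wmean => t _; exact: capw_cat.
Qed.

Definition capw_var n : R := wmean n (fun t => (capw t - mcap n) ^+ 2).

Lemma capw_varE n : capw_var n = wmean n (fun t => capw t ^+ 2) - mcap n ^+ 2.
Proof.
rewrite /capw_var (_ : (fun t => (capw t - mcap n) ^+ 2) =
  (fun t => capw t ^+ 2 - (2 * mcap n * capw t - mcap n ^+ 2))); last first.
  by apply/funext => t; ring.
rewrite !wmeanB// wmeanZ wmean_cst// -/(mcap n); ring.
Qed.

Lemma capw_var_ge0 n : 0 <= capw_var n.
Proof. by apply: wmean_ge0 => // t _; exact: sqr_ge0. Qed.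

(* Expanding (C(s) + C(t))^2 over independent s and t, the doubling of the second
   moment leaves an excess that telescopes along n, 2n, 4n, ... *)
Lemma capw_var_double n :
  capw_var n.*2 <= 2 * capw_var n + (2 * mcap n) ^+ 2 - mcap n.*2 ^+ 2.
Proof.
rewrite !capw_varE lerD2r -addnn wmean_cat.
have -> : 2 * (wmean n (fun t => capw t ^+ 2) - mcap n ^+ 2) + (2 * mcap n) ^+ 2 =
  wmean n (fun s => wmean n (fun t => capw s ^+ 2 + (2 * capw s * capw t + capw t ^+ 2))).
  under [RHS]eq_wmean do rewrite !wmeanD wmeanZ wmean_cst// -/(mcap n).
  rewrite !wmeanD wmean_cst//.
  under [X in _ = _ + (X + _)]eq_wmean do rewrite mulrAC.
  rewrite wmeanZ -/(mcap n); ring.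
apply: le_wmean => s _; apply: le_wmean => t _.
have := capw_cat R Gam0 Gam_sym s t; have := capw_ge0 R Gam0 (s ++ t).
set z := capw (s ++ t); set x := capw s; set y := capw t; nra.
Qed.

Lemma sum_capw_var_le m K : (0 < m)%N ->
  \sum_(k < K) capw_var (m * 2 ^ k) / (m * 2 ^ k)%:R ^+ 2 <=
  2 * (capw_var m + mcap m ^+ 2) / m%:R ^+ 2.
Proof.
move=> m0.
pose v k := capw_var (m * 2 ^ k) / (m * 2 ^ k)%:R ^+ 2.
pose b k := (mcap (m * 2 ^ k) / (m * 2 ^ k)%:R) ^+ 2.
(* After division by (2n)^2, [capw_var_double] says that 2 v + 2 b at k + 1 is at most v + 2 b at k,
   so 2 v + 2 b is a potential that drops by at least v at each doubling. *)
suff : \sum_(k < K) v k + 2 * v K + 2 * b K <= 2 * (v 0%N + b 0%N).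
  rewrite /v /b expn0 muln1 expr_div_n.
  have : 0 <= v K by rewrite divr_ge0 ?capw_var_ge0// sqr_ge0.
  have : 0 <= b K by exact: sqr_ge0.
  rewrite /v /b; lra.
elim: K => [|K IHK]; first by rewrite big_ord0; lra.
apply: le_trans IHK; rewrite big_ord_recr/=.
suff : 2 * v K.+1 + 2 * b K.+1 <= v K + 2 * b K by lra.
rewrite /v /b expnS mulnCA mul2n -muln2 natrM; set n := (m * 2 ^ K)%N.
have n0 : 0 < n%:R :> R by rewrite ltr0n muln_gt0 m0 expn_gt0.
rewrite muln2 !expr_div_n.
have -> : (n%:R * 2 : R) ^+ 2 = n%:R ^+ 2 * 4 by ring.
have := capw_var_double n; move: (capw_var n) (mcap n) (capw_var n.*2) (mcap n.*2) => a c a' c' H.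
have : 0 <= (n%:R ^+ 2 : R)^-1 by rewrite invr_ge0 sqr_ge0.
rewrite (invfM (n%:R ^+ 2)); move: (n%:R ^- 2) => w w0.
have := ler_wpM2r w0 H; lra.
Qed.

Lemma chebyshev_capw n (e : R) : 0 < e ->
  wmean n (fun t => (e <= `|capw t - mcap n|)%R%:R) <= capw_var n / e ^+ 2.
Proof.
move=> e0; rewrite /capw_var [leRHS]mulrC -wmeanZ; apply: le_wmean => t _.
rewrite mulrC ler_pdivlMr ?exprn_gt0//; case: (boolP (e <= `|capw t - mcap n|)) => H /=.
  by rewrite mul1r -[leRHS]real_normK ?num_real// ler_pXn2r// nnegrE// ltW.
by rewrite mul0r sqr_ge0.
Qed.

End Variance.

(** * From the probability space to means over words *)

Section Law.
Variables (R : realType) (G : groupType) (Gam : {fset G}).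
Hypothesis Gam0 : Gam != fset0.
Hypothesis Gam_gen : generates Gam.
Variables (disp : measure_display) (T : measurableType disp).
Variables (P : probability T R) (X : nat -> T -> G).
Hypothesis XP : iid_uniform_steps Gam P X.

Definition steps k n w : seq G := mkseq (fun i => X (k + i)%N w) n.

Lemma stepsS k n w : steps k n.+1 w = X k w :: steps k.+1 n w.
Proof.
rewrite /steps /mkseq /= addn0 -[iota 1 n]/(iota (1 + 0) n) iotaDl -map_comp.
by congr (_ :: _); apply: eq_map => i /=; rewrite add1n addSnnS.
Qed.

(** Split on the value of the first step: the union is countable because the group is. *)
Lemma measurable_steps k n (D : seq G -> Prop) : measurable [set w | D (steps k n w)].
Proof.
have [Xm _ _] := XP.
elim: n k D => [|n IHn] k D.
  have [d|d] := pselect (D [::]).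
    by rewrite (_ : [set _ | _] = setT)//; apply/seteqP; split.
  by rewrite (_ : [set _ | _] = set0)//; apply/seteqP; split.
rewrite (_ : [set _ | _] =
  \bigcup_x ((X k @^-1` [set x]) `&` [set w | D (x :: steps k.+1 n w)])).
  apply: countable_bigcupT_measurable; first exact: generates_countable Gam_gen.
  by move=> x; apply: measurableI; [exact: Xm|exact: (IHn k.+1 (fun s => D (x :: s)))].
apply/seteqP; split => w /=; first by rewrite stepsS => Dw; exists (X k w).
by move=> [x _ [/= <-]]; rewrite stepsS.
Qed.

Definition cylinder k (B : nat -> set G) : set T :=
  [set w | forall i, (i < k)%N -> B i (X i w)].

Lemma cylinderE k B :
  cylinder k B = \bigcap_(i in [set` [fset j in iota 0 k]%fset]) (X i @^-1` B i).
Proof.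
apply/seteqP; split => w H i; first by rewrite /= !inE mem_iota => /andP[_ ik]; exact: H.
by move=> ik; apply: H; rewrite /= !inE mem_iota.
Qed.

Lemma measurable_cylinder k B : measurable (cylinder k B).
Proof.
by have [Xm _ _] := XP; rewrite cylinderE; apply: bigcap_measurableType => i _; exact: Xm.
Qed.

Lemma P_cylinder k B : P (cylinder k B) = (\prod_(i < k) P (X i @^-1` B i))%E.
Proof.
have [_ _ ind] := XP; rewrite cylinderE ind.
rewrite -(big_mkord xpredT (fun i => P (X i @^-1` B i))) /index_iota subn0.
apply: perm_big; apply: uniq_perm; [exact: fset_uniq|exact: iota_uniq|].
by move=> i; rewrite !inE.
Qed.

Lemma P_cylinderS k B x : x \in Gam ->
  P (cylinder k.+1 (fun i => if i == k then [set x] else B i)) =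
  (P (cylinder k B) * ((#|` Gam|%:R)^-1)%:E)%E.
Proof.
move=> xG; have [_ unif _] := XP; rewrite !P_cylinder big_ord_recr/= eqxx unif.
congr (_ * _)%E.
  by apply: eq_bigr => i _; rewrite ltn_eqF.
rewrite (_ : [fset _ | _ in _ & _]%fset = [fset x]%fset) ?cardfs1 ?mul1r//.
apply/fsetP => y; rewrite !inE /=; apply/andP/eqP => [[_]|->]; rewrite ?in_setE//.
Qed.

(* Conditioning on a past cylinder lets the induction on n peel off the first step. *)
Lemma P_cylinder_steps n k B (D : seq G -> Prop) :
  P (cylinder k B `&` [set w | D (steps k n w)]) =
  (P (cylinder k B) * (wmean Gam n (fun t => `[< D t >]%:R))%:E)%E.
Proof.
have [Xm unif _] := XP.
elim: n k B D => [|n IHn] k B D.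
  rewrite /= /steps /=; have [d|d] := pselect (D [::]).
    by rewrite asboolT// mule1; congr (P _); apply/seteqP; split => w // [].
  by rewrite asboolF// mule0 -(measure0 P); congr (P _); apply/seteqP; split => w // [].
set E := _ `&` _.
have mE : measurable E.
  by apply: measurableI; [exact: measurable_cylinder|exact: measurable_steps].
pose F x := cylinder k.+1 (fun i => if i == k then [set x] else B i) `&`
            [set w | D (x :: steps k.+1 n w)].
have mF x : measurable (F x).
  apply: measurableI; first exact: measurable_cylinder.
  exact: (measurable_steps k.+1 n (fun s => D (x :: s))).
have FE x : F x = E `&` (X k @^-1` [set x]).
  apply/seteqP; split => w; rewrite /F /E /=.
    move=> [cw Dw]; have xw : X k w = x by have := cw k (ltnSn k); rewrite eqxx.
    split => //; split; last by rewrite stepsS xw.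
    move=> i ik; have := cw i (ltnW ik); rewrite ltn_eqF//.
  move=> [[cw]]; rewrite stepsS => Dw xw; split; last by rewrite -xw.
  by move=> i; rewrite ltnS leq_eqVlt; case: eqVneq => [->|_] //= ik; exact: cw.
(* Step k lies outside [Gam] with probability zero. *)
have -> : P E = P (\bigcup_(x in [set` Gam]) F x).
  have mG : measurable (X k @^-1` [set` Gam]) by exact: Xm.
  rewrite (_ : \bigcup_(x in _) F x = E `&` (X k @^-1` [set` Gam])); last first.
    apply/seteqP; split => w; first by move=> [x xG]; rewrite FE => -[? /= xw]; split => //=;
      rewrite xw.
    by move=> [Ew XG]; exists (X k w) => //; rewrite FE.
  rewrite -[E in LHS](setIT) -(setUv (X k @^-1` [set` Gam])) setIUr measureU//.
  - rewrite [X in (_ + X)%E](_ : _ = 0%E) ?adde0//.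
    apply: (@subset_measure0 _ _ _ P _ (~` (X k @^-1` [set` Gam]))) => //.
    + by apply: measurableI => //; exact: measurableC.
    + exact: measurableC.
    + apply: etrans (unif k (~` [set` Gam])) _; rewrite (_ : [fset _ | _ in _ & _]%fset = fset0).
        by rewrite cardfs0 mul0r.
      apply/fsetP => y; rewrite !inE/=; apply/negP => /andP[yG].
      by rewrite inE /= yG.
  - exact: measurableI.
  - by apply: measurableI => //; exact: measurableC.
  - by rewrite setIACA setICr setI0.
rewrite measure_fin_bigcup//; last first.
  by move=> x y _ _ [w []]; rewrite !FE => -[_ /= <-] [_ /= <-].
rewrite fsbig_finite//= set_fsetK.
transitivity (\sum_(x <- Gam) (P (cylinder k B) * ((#|` Gam|%:R)^-1 *
   wmean Gam n (fun t => `[< D (x :: t) >]%:R))%:E))%E.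
  rewrite big_seq [RHS]big_seq; apply: eq_bigr => x xG.
  rewrite /F (IHn k.+1 _ (fun t => D (x :: t))) P_cylinderS//.
  by rewrite -muleA EFinM.
rewrite -ge0_sume_distrr; last first.
  move=> x _; rewrite lee_fin mulr_ge0 ?invr_ge0 ?ler0n//.
  by apply: wmean_ge0 => // t _; rewrite ler0n.
by rewrite sumEFin /avg mulr_sumr.
Qed.

Lemma P_steps n (D : seq G -> Prop) :
  P [set w | D (steps 0 n w)] = (wmean Gam n (fun t => `[< D t >]%:R))%:E.
Proof.
have := P_cylinder_steps n 0 (fun=> setT) D.
rewrite (_ : cylinder 0 _ = setT); last by apply/seteqP; split.
by rewrite setTI probability_setT mul1e.
Qed.

Lemma walkE g n w : walk X g n w = (g * gprod (steps 0 n w))%g.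
Proof.
elim: n => [|n IHn] /=; first by rewrite gprod_nil mulg1.
by rewrite IHn /steps mkseqS gprod_rcons mulgA.
Qed.

Lemma take_steps k n w : (k <= n)%N -> take k (steps 0 n w) = steps 0 k w.
Proof. by move=> kn; rewrite /steps /mkseq -map_take take_iota (minn_idPl kn). Qed.

Lemma walk_rangeE n w : walk_range X n w = [set` trace (steps 0 n w)].
Proof.
apply/seteqP; split => x /=.
  move=> [k kn <-]; apply/traceP; exists k; first by rewrite size_mkseq.
  by rewrite take_steps// walkE mul1g.
move=> /traceP[k]; rewrite size_mkseq => kn ->; exists k => //.
by rewrite take_steps// walkE mul1g.
Qed.

Lemma return_time_infty A g :
  [set w | return_time R X [set` A] g w = +oo%E] =
  \bigcap_n [set w | escapes A g (steps 0 n w)].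
Proof.
apply/seteqP; split => w /=.
  move=> H n _ /=; apply/escapesP => k; rewrite size_mkseq => /andP[k0 kn].
  rewrite take_steps//; apply/negP => kA.
  suff : (return_time R X [set` A] g w <= k%:R%:E)%E by rewrite H leye_eq.
  by apply: ereal_inf_lbound; exists k => //=; rewrite walkE.
move=> H; rewrite /return_time /inf_nat (_ : [set _ | _ in _] = set0) ?ereal_inf0//.
apply/seteqP; split => // x [n [n0]]; rewrite walkE /= => nA _.
have /escapesP/(_ n) := H n I; rewrite size_mkseq n0 leqnn take_steps// nA.
by move/(_ isT).
Qed.

(** Never returning is the decreasing intersection of the events of escaping for n steps, so the
    measure is continuous along it. *)
Lemma P_return_infty A g :
  P [set w | return_time R X [set` A] g w = +oo%E] = (limn (fun n => esc R Gam n A g))%:E.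
Proof.
rewrite return_time_infty.
have mE n : measurable [set w | escapes A g (steps 0 n w)].
  exact: (measurable_steps 0 n (fun s => escapes A g s)).
have : P \o (fun n => [set w | escapes A g (steps 0 n w)]) @ \oo -->
       P (\bigcap_n [set w | escapes A g (steps 0 n w)]).
  apply: nonincreasing_cvg_mu => //.
  - by rewrite -ge0_fin_numE// fin_num_measure.
  - exact: bigcap_measurableType.
  - move=> m n mn; apply/subsetPset => w /= /escapesP H; apply/escapesP => k.
    rewrite size_mkseq => /andP[k0 km]; have := H k; rewrite size_mkseq k0.
    by rewrite (leq_trans km mn) !take_steps// ?(leq_trans km mn)//; exact.
move/cvg_lim => <- //; apply/cvg_lim => //.
rewrite (_ : _ \o _ = EFin \o (fun n => esc R Gam n A g)).
  by apply: cvg_EFin; [exact: nearW|exact: cvg_esc].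
apply/funext => n /=; rewrite (P_steps n (fun s => escapes A g s)); congr EFin.
by apply: eq_wmean => s _; rewrite asboolb.
Qed.

Lemma capacityE A : capacity P X [set` A] = (cap R Gam A)%:E.
Proof.
rewrite /capacity esum_fset//.
rewrite fsbig_finite//= set_fsetK.
under eq_bigr do rewrite P_return_infty.
rewrite sumEFin; congr EFin; apply/esym/cvg_lim => //.
apply: cvg_big => [|g _]; first exact: add_continuous.
exact: cvg_esc.
Qed.

Lemma capacity_of_rangeE n w : capacity_of_range P X n w = (capw R Gam (steps 0 n w))%:E.
Proof. by rewrite /capacity_of_range walk_rangeE capacityE. Qed.

End Law.

(** * Almost sure convergence *)

Section AlmostSure.
Variables (R : realType) (G : groupType) (Gam : {fset G}).
Hypothesis Gam0 : Gam != fset0.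
Hypothesis Gam_sym : symmetric_fset Gam.
Hypothesis Gam_gen : generates Gam.
Variables (disp : measure_display) (T : measurableType disp).
Variables (P : probability T R) (X : nat -> T -> G).
Hypothesis XP : iid_uniform_steps Gam P X.
Local Notation mcap := (@mcap R G Gam).
Local Notation capw := (@capw R G Gam).
Local Notation mu := (growth_rate mcap).

Definition deviation m j k : set T :=
  [set w | (m * 2 ^ k)%:R / j.+1%:R <=
           `|capw (steps X 0 (m * 2 ^ k) w) - mcap (m * 2 ^ k)|].

(** Borel-Cantelli, with Chebyshev and the summable variances. *)
Lemma P_lim_sup_deviation m j : (0 < m)%N -> P (lim_sup_set (deviation m j)) = 0.
Proof.
move=> m0; apply: lim_sup_set_cvg0 => [k|].
  exact: (measurable_steps Gam_gen XP 0 _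
    (fun s => (m * 2 ^ k)%:R / j.+1%:R <= `|capw s - mcap (m * 2 ^ k)|)).
pose B := j.+1%:R ^+ 2 * (2 * (capw_var R Gam m + mcap m ^+ 2) / m%:R ^+ 2).
apply: (@le_lt_trans _ _ B%:E); last by rewrite ltry.
apply: lime_le; first by apply: is_cvg_nneseries => n _ _; exact: measure_ge0.
apply: nearW => K; rewrite big_mkord.
apply: (@le_trans _ _ (\sum_(k < K) (j.+1%:R ^+ 2 * (capw_var R Gam (m * 2 ^ k) / (m * 2 ^ k)%:R
  ^+ 2))%:E)%E).
  apply: lee_sum => k _.
  have PF : P (deviation m j k) = (wmean Gam (m * 2 ^ k) (fun s =>
      ((m * 2 ^ k)%:R / j.+1%:R <= `|capw s - mcap (m * 2 ^ k)|)%R%:R))%:E.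
    apply: etrans (P_steps Gam0 Gam_gen XP _
      (fun s => (m * 2 ^ k)%:R / j.+1%:R <= `|capw s - mcap (m * 2 ^ k)|)) _.
    by congr EFin; apply: eq_wmean => s _; rewrite asboolb.
  rewrite -[leLHS]/(P (deviation m j k)) PF lee_fin.
  have n0 : 0 < (m * 2 ^ k)%:R :> R by rewrite ltr0n muln_gt0 m0 expn_gt0.
  have j0 : 0 < (m * 2 ^ k)%:R / j.+1%:R :> R by rewrite divr_gt0// ltr0n.
  apply: le_trans (chebyshev_capw Gam (m * 2 ^ k) j0) _.
  by rewrite expr_div_n invf_div mulrCA.
rewrite sumEFin lee_fin -mulr_sumr ler_wpM2l ?sqr_ge0//.
exact: sum_capw_var_le.
Qed.

(** Outside the exceptional sets the capacity over n = m 2^k stays close to its mean over n, which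
    tends to [mu] by Fekete; [cvg_dyadic_filling] then covers all n. *)
Lemma cvg_capw_steps w :
  (forall m j, ~ lim_sup_set (deviation m.+1 j) w) ->
  (fun n => capw (steps X 0 n w) / n%:R) @ \oo --> mu.
Proof.
move=> H; apply: (@cvg_dyadic_filling R (fun n => capw (steps X 0 n w))) => [n|n n' nn'|[//|m] _].
- exact: capw_ge0.
- rewrite -(subnKC nn') /steps /mkseq iotaD map_cat; exact: capw_catl.
apply/cvgrPdist_le => e e0.
have e20 : 0 < e / 2 by lra.
have [j jP] : exists j : nat, j.+1%:R^-1 < e / 2.
  have [j jP] : exists j : nat, (e / 2)^-1 < j%:R.
    exists (Num.bound `|(e / 2)^-1|).
    exact: le_lt_trans (ler_norm _) (archi_boundP (normr_ge0 _)).
  exists j; rewrite invf_plt ?posrE// ?ltr0n//.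
  by apply: lt_le_trans jP _; rewrite ler_nat.
have [K KP] : exists K, forall k, (K <= k)%N -> ~ deviation m.+1 j k w.
  apply: contrapT => /forallNP nK; apply: (H m j) => K _.
  have /existsNP[k /not_implyP[Kk /contrapT dk]] := nK K.
  by exists k.
have [N NP] := cvg_growth_rate (mcap_ge0 R Gam0) (mcap_sub R Gam0 Gam_sym) e20.
exists (maxn K N) => // k; rewrite /= geq_max => /andP[Kk Nk].
have n0 : (0 < m.+1 * 2 ^ k)%N by rewrite muln_gt0 expn_gt0.
have Nn : (N <= m.+1 * 2 ^ k)%N.
  rewrite (leq_trans Nk)// (leq_trans (ltnW (ltn_expl k (isT : 1 < 2)%N)))//.
  by rewrite leq_pmull.
have := NP _ Nn; have := growth_rate_le (mcap_ge0 R Gam0) n0.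
have := KP _ Kk; rewrite /deviation /= => /negP; rewrite -ltNge.
set n := (m.+1 * 2 ^ k)%N in n0 *; have nr0 : 0 < n%:R :> R by rewrite ltr0n.
set c := capw _; set b := mcap n => Hc.
have {}Hc : `|c / n%:R - b / n%:R| < e / 2.
  rewrite -mulrBl normrM (ger0_norm (x := n%:R^-1)) ?invr_ge0 ?ler0n//.
  rewrite ltr_pdivrMr//; apply: lt_trans Hc _.
  by rewrite mulrC ltr_pM2r.
move: Hc; rewrite ltr_norml ler_norml => /andP[h1 h2] h3 h4; lra.
Qed.

Lemma ae_cvg_capacity :
  {ae P, forall w, (fun n : nat => (capacity_of_range P X n w * (n%:R^-1)%:E)%E)
              @ \oo --> mu%:E}.
Proof.
have : {ae P, forall w, forall m j, ~ lim_sup_set (deviation m.+1 j) w}.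
  apply: ae_foralln => m; apply: ae_foralln => j.
  exists (lim_sup_set (deviation m.+1 j)); split => //.
  - apply: bigcap_measurable => // n _; apply: bigcup_measurable => k _.
    exact: (measurable_steps Gam_gen XP 0 _
      (fun s => (m.+1 * 2 ^ k)%:R / j.+1%:R <= `|capw s - mcap (m.+1 * 2 ^ k)|)).
  - exact: P_lim_sup_deviation.
  - by move=> w /= /contrapT.
apply: filterS => w /cvg_capw_steps H.
rewrite (_ : (fun n : nat => _) = EFin \o (fun n => capw (steps X 0 n w) / n%:R)).
  by apply: cvg_EFin => //; exact: nearW.
by apply/funext => n /=; rewrite (capacity_of_rangeE Gam0 Gam_gen XP).
Qed.

End AlmostSure.

(** * Distinct values of S_i T_j^-1 *)

Section ImageSize.
Variables (R : realType) (I : finType) (K : choiceType) (f : I -> K) (H : {fset K}).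

Definition mult v : nat := #|[pred i | f i == v]|.

Lemma multE v : (mult v)%:R = \sum_i (f i == v)%:R :> R.
Proof. by rewrite /mult -sum1_card natr_sum big_mkcond; apply: eq_bigr => i _; rewrite inE;
  case: eqP. Qed.

Lemma sum_fset_eq1 (y : K) : \sum_(v <- H) (y == v)%:R = (y \in H)%:R :> R.
Proof.
have [yH|yH] := boolP (y \in H).
  rewrite (big_fsetD1 y)//= eqxx big_seq big1 ?addr0// => v.
  by rewrite !inE => /andP[vy _]; rewrite eq_sym (negPf vy).
by rewrite big_seq big1// => v vH; case: eqP => // yv; rewrite yv vH in yH.
Qed.

Lemma sum_mult : \sum_(v <- H) (mult v)%:R = \sum_i (f i \in H)%:R :> R.
Proof.
under eq_bigr do rewrite multE.
by rewrite exchange_big; apply: eq_bigr => i _; exact: sum_fset_eq1.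
Qed.

(* Expand sum_(v in H) (1 - l mult v)^2 >= 0. *)
Lemma image_size_ge (l : R) : (forall i, f i \in H) ->
  2 * l * #|I|%:R - l ^+ 2 * (\sum_i \sum_j (f i == f j)%:R) <= #|` H|%:R.
Proof.
move=> fH; have : 0 <= \sum_(v <- H) (1 - l * (mult v)%:R) ^+ 2.
  by apply: sumr_ge0 => v _; exact: sqr_ge0.
have -> : \sum_(v <- H) (1 - l * (mult v)%:R) ^+ 2 =
   \sum_(v <- H) 1 - 2 * l * (\sum_(v <- H) (mult v)%:R) +
   l ^+ 2 * \sum_(v <- H) (mult v)%:R ^+ 2.
  rewrite !mulr_sumr -sumrB -big_split; apply: eq_bigr => v _ /=; ring.
have -> : \sum_(v <- H) 1 = #|` H|%:R :> R.
  by rewrite big_const_seq count_predT iter_addr_0.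
have -> : \sum_(v <- H) (mult v)%:R = #|I|%:R :> R.
  rewrite sum_mult -sum1_card natr_sum; apply: eq_bigr => i _; by rewrite fH.
have -> : \sum_(v <- H) (mult v)%:R ^+ 2 = \sum_i \sum_j (f i == f j)%:R :> R.
  under eq_bigr do rewrite expr2 [X in X * _]multE mulr_suml.
  rewrite exchange_big; apply: eq_bigr => i _ /=.
  under eq_bigr do rewrite multE mulr_sumr.
  rewrite exchange_big; apply: eq_bigr => j _ /=.
  rewrite (big_fsetD1 (f i))//= eqxx mul1r eq_sym big_seq big1 ?addr0// => v.
  by rewrite !inE eq_sym => /andP[/negPf -> _]; rewrite mul0r.
lra.
Qed.

(** Values taken at least M times number at most |I| / M; each other value is charged to an index
    that takes it. *)
Lemma image_size_le (M : nat) : (0 < M)%N -> (forall v, v \in H -> exists i, f i = v) ->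
  #|` H|%:R <= #|I|%:R / M%:R + \sum_i (mult (f i) < M)%N%:R :> R.
Proof.
move=> M0 Hf; have M0' : 0 < M%:R :> R by rewrite ltr0n.
apply: (@le_trans _ _ (\sum_(v <- H)
   ((mult v)%:R / M%:R + \sum_i (f i == v)%:R * (mult (f i) < M)%N%:R))).
  have -> : #|` H|%:R = \sum_(v <- H) 1 :> R.
    by rewrite big_const_seq count_predT iter_addr_0.
  rewrite big_seq [leRHS]big_seq; apply: ler_sum => v /Hf[i <-].
  have [Mm|Mm] := ltnP (mult (f i)) M.
    rewrite ler_wpDl ?divr_ge0 ?ler0n// (bigD1 i)//= eqxx Mm mulr1 ler_wpDr//.
    by apply: sumr_ge0 => j _; rewrite mulr_ge0 ?ler0n.
  rewrite ler_wpDr//; first by apply: sumr_ge0 => j _; rewrite mulr_ge0 ?ler0n.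
  by rewrite ler_pdivlMr// mul1r ler_nat.
rewrite big_split/= lerD//.
  rewrite -mulr_suml ler_wpM2r ?invr_ge0 ?ler0n// sum_mult -sum1_card natr_sum.
  by apply: ler_sum => i _; rewrite ler_nat leq_b1.
rewrite exchange_big/=; apply: ler_sum => i _; rewrite -mulr_suml sum_fset_eq1.
by rewrite ler_piMl ?ler0n// -[leRHS]/(1%:R) ler_nat leq_b1.
Qed.

End ImageSize.

Section Sums.
Variable R : realType.
Implicit Types g u : nat -> R.

(** With truncated subtraction the argument of [g] is the distance |i - j|, and each distance occurs
    at most twice. *)
Lemma sum_dist_le g a i : (forall k, 0 <= g k) -> (i < a)%N ->
  \sum_(j < a) g ((i - j) + (j - i))%N <= 2 * \sum_(k < a) g k.
Proof.
move=> g0 ia; have -> : 2 * \sum_(k < a) g k = \sum_(k < a) g k + \sum_(k < a) g k.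
  ring.
rewrite -!(big_mkord xpredT (fun k => g k)) -(big_mkord xpredT (fun j => g ((i - j) + (j - i))%N)).
rewrite (@big_cat_nat _ _ _ i.+1 0 a)//= lerD//.
  apply: (@le_trans _ _ (\sum_(0 <= k < i.+1) g k)).
    rewrite big_nat_rev/= add0n le_eqVlt; apply/orP; left; apply/eqP.
    apply: eq_big_nat => k /andP[_ ki]; congr g; lia.
  by rewrite [leRHS](@big_cat_nat _ _ _ i.+1)//= ler_wpDr// sumr_ge0.
apply: (@le_trans _ _ (\sum_(0 <= k < a - i) g k)).
  rewrite -{1}(add0n i.+1) big_addn -(subnSK ia) [leRHS]big_nat_recl//.
  rewrite ler_wpDl//; apply: ler_sum_nat => k _.
  rewrite (_ : _ + _ = k.+1)%N//; lia.
by rewrite [leRHS](@big_cat_nat _ _ _ (a - i))//= ?leq_subr// ler_wpDr// sumr_ge0.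
Qed.

(** There are at most s + 1 pairs with sum s. *)
Lemma double_sum_le u a b : (forall k, 0 <= u k) ->
  \sum_(k < a) \sum_(l < b) u (k + l)%N <= \sum_(s < a + b) s.+1%:R * u s.
Proof.
move=> u0.
(* The weight min(a, s + 1) keeps track of a and makes the induction on a possible. *)
suff : \sum_(k < a) \sum_(l < b) u (k + l)%N <=
    \sum_(0 <= s < a + b) (minn a s.+1)%:R * u s.
  move/le_trans; apply; rewrite big_mkord; apply: ler_sum => s _.
  by rewrite ler_wpM2r// ler_nat geq_minr.
elim: a => [|a IHa]; first by rewrite big_ord0 sumr_ge0// => s _; rewrite mulr_ge0.
rewrite big_ord_recr/= addSn big_nat_recr/=; last by [].
have -> : \sum_(l < b) u (a + l)%N = \sum_(0 <= s < a + b) (a <= s)%N%:R * u s.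
  rewrite (@big_cat_nat _ _ _ a)//=; last by rewrite leq_addr.
  rewrite [X in _ = X + _]big_nat [X in _ = X + _]big1 ?add0r; last first.
    by move=> s /andP[_ sa]; rewrite leqNgt sa mul0r.
  transitivity (\sum_(0 + a <= s < a + b) (a <= s)%N%:R * u s); last by rewrite add0n.
  rewrite big_addn addKn big_mkord; apply: eq_bigr => l _.
  by rewrite leq_addl mul1r addnC.
apply: (@le_trans _ _ (\sum_(0 <= s < a + b) (minn a.+1 s.+1)%:R * u s)); last first.
  by rewrite ler_wpDr// mulr_ge0.
apply: le_trans (lerD IHa (lexx _)) _; rewrite -big_split/=.
apply: ler_sum => s _; rewrite -mulrDl ler_wpM2r// -natrD ler_nat; lia.
Qed.

End Sums.

(** * Collisions, and positivity of the rate when the series converges *)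

Section Grid.
Variables (R : realType) (G : groupType) (Gam : {fset G}).
Hypothesis Gam0 : Gam != fset0.
Hypothesis Gam_sym : symmetric_fset Gam.
Local Notation wmean := (@wmean R G Gam).
Local Notation heat := (@heat R G Gam).
Local Notation ret := (@ret R G Gam).
Local Notation mhit := (@mhit R G Gam).
Local Notation mcap := (@mcap R G Gam).
Local Notation pos k s := (gprod (take k s)).

Lemma wmean_catE n m k (f : seq G -> R) : k = (n + m)%N ->
  wmean k f = wmean n (fun s => wmean m (fun t => f (s ++ t))).
Proof. by move=> ->; exact: wmean_cat. Qed.

Lemma wmean_pos2 n i i' (F : G -> G -> R) : (i <= i')%N -> (i' <= n)%N ->
  wmean n (fun s => F (pos i s) (pos i' s)) =
  wmean i (fun s => wmean (i' - i) (fun t => F (gprod s) (gprod s * gprod t)%g)).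
Proof.
move=> ii' i'n; rewrite (@wmean_catE i (n - i)); last lia.
apply: eq_wmean => s /andP[/eqP si _].
rewrite (@wmean_catE (i' - i) (n - i')); last lia.
apply: eq_wmean => t /andP[/eqP ti _].
rewrite -[RHS](wmean_cst Gam0 (n - i')); apply: eq_wmean => r _.
rewrite -gprod_cat take_size_cat// catA take_size_cat//.
by rewrite size_cat si ti subnKC.
Qed.

(** Stationary increments; when k' < k the increment is read backwards, which time reversal
    allows. *)
Lemma wmean_pos n k k' (h : G -> R) : (k <= n)%N -> (k' <= n)%N ->
  wmean n (fun s => h ((pos k s)^-1 * pos k' s)%g) =
  wmean ((k - k') + (k' - k))%N (fun s => h (gprod s)).
Proof.
have [kk'|/ltnW k'k] := leqP k k' => kn k'n.
  rewrite (wmean_pos2 (fun x y => h (x^-1 * y)%g) kk' k'n).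
  rewrite -[RHS](wmean_cst Gam0 k); apply: eq_wmean => s _.
  rewrite (_ : (k - k' + (k' - k) = k' - k)%N); last lia.
  by apply: eq_wmean => t _; rewrite mulKg.
rewrite (wmean_pos2 (fun x y => h (y^-1 * x)%g) k'k kn).
rewrite -[RHS](wmean_cst Gam0 k'); apply: eq_wmean => s _.
rewrite (_ : (k - k' + (k' - k) = k - k')%N); last lia.
rewrite -[RHS](wmean_inv_word Gam0 Gam_sym).
by apply: eq_wmean => t _; rewrite gprod_inv_word invgM mulgVK.
Qed.

Lemma wmean_eq n m : wmean n (fun s => wmean m (fun t => (gprod s == gprod t)%:R)) =
  heat (n + m) 1%g.
Proof.
rewrite heatE// wmean_cat; apply: eq_wmean => s _.
rewrite -[RHS](wmean_inv_word Gam0 Gam_sym); apply: eq_wmean => t _.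
by rewrite gprod_cat gprod_inv_word divg_eq1.
Qed.

(** A collision says that the increment of one walk between k and k' equals that of the other
    between l and l'; joined together, the two increments form a loop. *)
Lemma wmean_coll n m k k' l l' : (k <= n)%N -> (k' <= n)%N -> (l <= m)%N -> (l' <= m)%N ->
  wmean n (fun s => wmean m (fun t =>
    (pos k s * (pos l t)^-1 == pos k' s * (pos l' t)^-1)%g%:R)) =
  heat ((k - k') + (k' - k) + ((l - l') + (l' - l)))%N 1%g.
Proof.
move=> kn k'n lm l'm; rewrite -wmean_eq.
rewrite -(wmean_pos (fun x => wmean _ (fun t => (x == gprod t)%:R)) kn k'n).
apply: eq_wmean => s _.
rewrite -(wmean_pos (fun y => (_ == y)%:R) lm l'm).
apply: eq_wmean => t _; congr (_%:R); congr nat_of_bool.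
rewrite -(inj_eq (@mulgI _ (pos k s)^-1%g)) mulKg -(inj_eq (@mulIg _ (pos l' t))).
by rewrite -!mulgA mulVg mulg1 eq_sym.
Qed.

Lemma mem_hit_trace (s t : seq G) i j : (i <= size s)%N -> (j <= size t)%N ->
  (pos i s * (pos j t)^-1)%g \in hit (trace s) t.
Proof.
move=> si tj; apply/hitP; exists (pos i s), j; split => //.
by apply/traceP; exists i.
Qed.

(** Second moment bound [image_size_ge] on the grid of even times, where all collision probabilities
    are values of [ret]. *)
Lemma mhit_ge n m a b (K : R) : (a.*2 <= n.+1)%N -> (b.*2 <= m.+1)%N -> 0 < K ->
  (forall L, \sum_(s < L) s.+1%:R * ret s <= K) ->
  a%:R * b%:R / (4 * K) <= mhit n m.
Proof.
move=> an bm K0 HK.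
pose f (s t : seq G) (p : 'I_a * 'I_b) := (pos p.1.*2 s * (pos p.2.*2 t)^-1)%g.
have dbl (x c n' : nat) : (c.*2 <= n'.+1)%N -> (x < c)%N -> (x.*2 <= n')%N by lia.
(* The maximizer of 2 l - 4 K l^2, where 4 K bounds the expected collisions of one grid point. *)
pose l : R := (4 * K)^-1; have l0 : 0 < l by rewrite invr_gt0; lra.
have fE s t : word Gam n s -> word Gam m t ->
    2 * l * (a * b)%:R - l ^+ 2 * (\sum_p \sum_q (f s t p == f s t q)%:R) <=
    #|` hit (trace s) t|%:R.
  move=> /andP[/eqP sn _] /andP[/eqP tm _].
  have := @image_size_ge R _ _ (f s t) (hit (trace s) t) l.
  rewrite card_prod !card_ord; apply => -[[i ia] [j jb]]; rewrite /f /=.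
  by apply: mem_hit_trace; rewrite ?sn ?tm; lia.
apply: (@le_trans _ _ (wmean n (fun s => wmean m (fun t =>
   2 * l * (a * b)%:R - l ^+ 2 * (\sum_p \sum_q (f s t p == f s t q)%:R))))); last first.
  by apply: le_wmean => s sw; apply: le_wmean => t tw; exact: fE.
have -> : wmean n (fun s => wmean m (fun t =>
   2 * l * (a * b)%:R - l ^+ 2 * (\sum_p \sum_q (f s t p == f s t q)%:R))) =
   2 * l * (a * b)%:R - l ^+ 2 *
     (\sum_(p : 'I_a * 'I_b) \sum_(q : 'I_a * 'I_b)
        ret ((p.1 - q.1) + (q.1 - p.1) + ((p.2 - q.2) + (q.2 - p.2)))%N).
  under eq_wmean do rewrite wmeanB// wmean_cst// wmeanZ wmean_sum//.
  rewrite wmeanB// wmean_cst// wmeanZ wmean_sum//; congr (_ - _ * _).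
  apply: eq_bigr => p _; under eq_wmean do rewrite wmean_sum//.
  rewrite wmean_sum//; apply: eq_bigr => q _.
  rewrite /f wmean_coll; last 4 first.
  - exact: dbl an (ltn_ord _).
  - exact: dbl an (ltn_ord _).
  - exact: dbl bm (ltn_ord _).
  - exact: dbl bm (ltn_ord _).
  have dblB (x y z w : nat) : (x.*2 - y.*2 + (y.*2 - x.*2) + (z.*2 - w.*2 + (w.*2 - z.*2)) =
    (x - y + (y - x) + (z - w + (w - z))) + (x - y + (y - x) + (z - w + (w - z))))%N by lia.
  by rewrite /ret dblB.
have r0 k : 0 <= ret k by exact: ret_ge0.
(* Each coordinate contributes a factor 2, the two signs of a time difference. *)
have : \sum_(p : 'I_a * 'I_b) \sum_(q : 'I_a * 'I_b)
        ret ((p.1 - q.1) + (q.1 - p.1) + ((p.2 - q.2) + (q.2 - p.2)))%N <=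
     \sum_(p : 'I_a * 'I_b) (4 * K).
  apply: ler_sum => -[i j] _ /=.
  rewrite -(pair_bigA _ (fun (i' : 'I_a) (j' : 'I_b) =>
    ret ((i - i') + (i' - i) + ((j - j') + (j' - j)))%N))/=.
  apply: le_trans (sum_dist_le (g := fun d => \sum_(j' < b) ret (d + ((j - j') + (j' - j)))%N)
    _ (ltn_ord i)) _; first by move=> k; exact: sumr_ge0.
  rewrite (_ : 4 = 2 * 2 :> R); last ring.
  rewrite -mulrA ler_pM2l//.
  apply: (@le_trans _ _ (\sum_(k < a) 2 * \sum_(l < b) ret (k + l)%N)).
    apply: ler_sum => k _; apply: (sum_dist_le (g := fun l => ret (k + l)%N)) => //.
  rewrite -mulr_sumr ler_pM2l//.
  by apply: le_trans (double_sum_le _ _ _) (HK _).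
rewrite sumr_const card_prod !card_ord -[(4 * K) *+ _]mulr_natr !natrM -/l.
set S := \sum_p _ => HS.
have : l ^+ 2 * S <= l ^+ 2 * (4 * K * (a%:R * b%:R)) by rewrite ler_wpM2l ?sqr_ge0.
have -> : l ^+ 2 * (4 * K * (a%:R * b%:R)) = l * (a%:R * b%:R).
  by rewrite /l; field; lra.
rewrite -/l; lra.
Qed.

Lemma growth_rate_gt0 (K : R) : 0 < K ->
  (forall L, \sum_(s < L) s.+1%:R * ret s <= K) -> 0 < growth_rate mcap.
Proof.
move=> K0 HK; have K16 : 0 < (16 * K)^-1 by rewrite invr_gt0; lra.
apply: lt_le_trans K16 _; apply: growth_rate_ge => n n0.
rewrite ler_pdivlMr ?ltr0n//; apply: (@mcap_ge _ _ _ Gam0 Gam_sym _ _ 0) => m.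
rewrite addr0; apply: le_trans (@mhit_ge n m n.+1./2 m.+1./2 K _ _ K0 HK); last 2 first.
- by rewrite -{2}(odd_double_half n.+1) leq_addl.
- by rewrite -{2}(odd_double_half m.+1) leq_addl.
have half k : k%:R <= 2 * k.+1./2%:R :> R.
  by rewrite -natrM ler_nat mul2n; lia.
have -> : m%:R * ((16 * K)^-1 * n%:R) = (m%:R * n%:R) / (4 * (4 * K)).
  by rewrite mulrCA mulrC mulrA; congr (_ / _); ring.
rewrite invfM !mulrA ler_wpM2r ?invr_ge0//; first lra.
rewrite ler_pdivrMr//.
apply: le_trans (ler_pM _ _ (half m) (half n)) _ => //; lra.
Qed.

End Grid.

(** * Bounding the rate by the probability of few meetings *)

Section Intersections.
Variables (R : realType) (G : groupType) (Gam : {fset G}).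
Hypothesis Gam0 : Gam != fset0.
Hypothesis Gam_sym : symmetric_fset Gam.
Local Notation wmean := (@wmean R G Gam).
Local Notation mhit := (@mhit R G Gam).
Local Notation mcap := (@mcap R G Gam).
Local Notation pos k s := (gprod (take k s)).
Implicit Types (s t a b : seq G).

Definition inter m (z : G) a b : nat :=
  #|[pred p : 'I_m * 'I_m | pos p.1.*2 a == (z * pos p.2.*2 b)%g]|.

(* The probability that two walks of 2m steps, started at 1 and z, meet fewer than M
   times, meetings being counted with multiplicity at even times. *)
Definition few m M (z : G) : R :=
  wmean m.*2 (fun a => wmean m.*2 (fun b => (inter m z a b < M)%N%:R)).

Lemma inter_catl m z a a' b : size a = m.*2 -> inter m z (a ++ a') b = inter m z a b.
Proof.
move=> sa; apply: eq_card => -[k l]; rewrite !inE /= takel_cat//.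
by rewrite sa leq_double ltnW.
Qed.

Lemma inter_catr m z a b b' : size b = m.*2 -> inter m z a (b ++ b') = inter m z a b.
Proof.
move=> sb; apply: eq_card => -[k l]; rewrite !inE /= [take _ (b ++ _)]takel_cat//.
by rewrite sb leq_double ltnW.
Qed.

(** If the walks restarted at times i and j meet, the two later positions represent the same
    quotient as those at i and j. *)
Lemma inter_le_mult m n k s t (i : 'I_n.+1) (j : 'I_k.+1) :
  (i + m.*2 <= n)%N -> (j + m.*2 <= k)%N ->
  (inter m 1 (drop i s) (drop j t) <=
   mult (fun p : 'I_n.+1 * 'I_k.+1 => pos p.1 s * (pos p.2 t)^-1)%g
        (pos i s * (pos j t)^-1)%g)%N.
Proof.
move=> im jm; rewrite /inter /mult.
pose g (p : 'I_m * 'I_m) : 'I_n.+1 * 'I_k.+1 :=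
  (inord (i + p.1.*2), inord (j + p.2.*2)).
have b1 (x : 'I_m) : (i + x.*2 < n.+1)%N.
  by have := ltn_ord x; move: (nat_of_ord x) (nat_of_ord i) im => x' i'; lia.
have b2 (x : 'I_m) : (j + x.*2 < k.+1)%N.
  by have := ltn_ord x; move: (nat_of_ord x) (nat_of_ord j) jm => x' i'; lia.
have gi : injective g.
  move=> [x y] [x' y'] [] /(congr1 val) + /(congr1 val); rewrite /= !inordK//.
  move=> /addnI/double_inj/val_inj -> /addnI/double_inj/val_inj -> //.
rewrite -(fintype.card_image gi); apply: subset_leq_card;
  apply/fintype.subsetP => q /fintype.imageP[[x y]].
rewrite !inE /= => /eqP E ->; rewrite /g /= !inordK// !takeD !gprod_cat E mul1g.
by rewrite invgM mulgA mulgK.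
Qed.

Lemma wmean_drop n m i (F : seq G -> R) : (i + m <= n)%N ->
  (forall a r, size a = m -> F (a ++ r) = F a) ->
  wmean n (fun s => F (drop i s)) = wmean m F.
Proof.
move=> imn HF; rewrite (@wmean_catE _ _ _ i (n - i)); last lia.
rewrite -[RHS](wmean_cst Gam0 i); apply: eq_wmean => s /andP[/eqP si _].
rewrite (@wmean_catE _ _ _ m (n - i - m)); last lia.
apply: eq_wmean => a /andP[/eqP am _].
rewrite -[RHS](wmean_cst Gam0 (n - i - m)); apply: eq_wmean => r _.
by rewrite drop_size_cat// HF.
Qed.

Lemma sum_last_le n c : \sum_(i < n.+1) (n < i + c)%N%:R <= c%:R :> R.
Proof.
rewrite (reindex_inj rev_ord_inj) /=.
have -> : \sum_(j < n.+1) (n < n.+1 - j.+1 + c)%N%:R = \sum_(j < n.+1) (j < c)%N%:R :> R.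
  apply: eq_bigr => j _; congr (_%:R); congr nat_of_bool.
  by have := ltn_ord j; move: (nat_of_ord j) => j'; lia.
suff : forall N, \sum_(j < N) (j < c)%N%:R <= (minn N c)%:R :> R.
  by move=> /(_ n.+1)/le_trans; apply; rewrite ler_nat geq_minr.
elim=> [|N IHN]; first by rewrite big_ord0 ler0n.
rewrite big_ord_recr/=; apply: le_trans (lerD IHN (lexx _)) _.
by rewrite -natrD ler_nat; lia.
Qed.

(** Apply [image_size_le]: a value of small multiplicity forces few meetings after times i and j.
    The last term counts the pairs too close to the end for a full window of length 2m. *)
Lemma mhit_le n k m M : (0 < M)%N ->
  mhit n k <= n.+1%:R * k.+1%:R * (M%:R^-1 + few m M 1%g) +
              m.*2%:R * (n.+1%:R + k.+1%:R).
Proof.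
move=> M0.
pose f s t (p : 'I_n.+1 * 'I_k.+1) := (pos p.1 s * (pos p.2 t)^-1)%g.
have few0 : 0 <= few m M 1%g by do 2!(apply: wmean_ge0 => // ? _); rewrite ler0n.
apply: (@le_trans _ _ (wmean n (fun s => wmean k (fun t =>
   (n.+1 * k.+1)%:R / M%:R + \sum_p (mult (f s t) (f s t p) < M)%N%:R)))).
  apply: le_wmean => s /andP[/eqP sn _]; apply: le_wmean => t /andP[/eqP tk _].
  have := @image_size_le R _ _ (f s t) (hit (trace s) t) M M0.
  rewrite card_prod !card_ord; apply => v /hitP[a [j [/traceP[i si ->] tj ->]]].
  rewrite sn in si; rewrite tk in tj.
  have i1 : (i < n.+1)%N by []. have j1 : (j < k.+1)%N by [].
  by exists (Ordinal i1, Ordinal j1).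
under eq_wmean do rewrite wmeanD wmean_cst// wmean_sum//.
rewrite wmeanD wmean_cst// wmean_sum// natrM mulrDr -addrA lerD//.
apply: (@le_trans _ _ (\sum_(p : 'I_n.+1 * 'I_k.+1)
    (few m M 1%g + ((n < p.1 + m.*2)%N%:R + (k < p.2 + m.*2)%N%:R)))).
  apply: ler_sum => -[i j] _ /=.
  have le1 : wmean n (fun s => wmean k (fun t => (mult (f s t) (f s t (i, j)) < M)%N%:R)) <= 1.
    rewrite -[leRHS](wmean_cst Gam0 n); apply: le_wmean => s _.
    rewrite -[leRHS](wmean_cst Gam0 k); apply: le_wmean => t _.
    by rewrite -[leRHS]/(1%:R) ler_nat leq_b1.
  have [/= im|im /=] := ltnP n (i + m.*2).
    by apply: le_trans le1 _; rewrite addrA ler_wpDr ?ler0n// ler_wpDl.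
  have [/= jm|jm /=] := ltnP k (j + m.*2).
    by apply: le_trans le1 _; rewrite add0r ler_wpDl.
  rewrite !addr0 /few.
  rewrite -(wmean_drop (F := fun a => wmean m.*2 (fun b => (inter m 1 a b < M)%N%:R)) im).
    apply: le_wmean => s _.
    rewrite -(wmean_drop (F := fun b => (inter m 1 (drop i s) b < M)%N%:R) jm).
      apply: le_wmean => t _; rewrite ler_nat.
      have := inter_le_mult s t im jm; rewrite -/(f s t) /f /=.
      by case: (ltnP (mult _ _)) => // h1 h2; rewrite (leq_ltn_trans h2 h1).
    by move=> b r bm; rewrite inter_catr.
  by move=> a r am; apply: eq_wmean => b _; rewrite inter_catl.
rewrite big_split/= sumr_const card_prod !card_ord -[few _ _ _ *+ _]mulr_natr natrM.
rewrite mulrC lerD// -(pair_bigA _ (fun (i : 'I_n.+1) (j : 'I_k.+1) =>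
  (n < i + m.*2)%N%:R + (k < j + m.*2)%N%:R))/=.
under eq_bigr do rewrite big_split/= sumr_const card_ord -[X in X + _]mulr_natr.
rewrite big_split/= sumr_const card_ord -[X in _ + X]mulr_natr -mulr_suml mulrDr.
by rewrite addrC lerD// ler_wpM2r// sum_last_le.
Qed.

(** Let k and then n tend to infinity in [mhit_le]: the boundary term adds only 2m to the slope in
    k, which vanishes on division by n. *)
Lemma growth_rate_le_few m M : (0 < M)%N ->
  growth_rate mcap <= M%:R^-1 + few m M 1%g.
Proof.
move=> M0; set e := _ + few _ _ _.
apply: (@archi_le _ _ _ (e + m.*2%:R)) => n.
have [->|n0] := posnP n.
  rewrite !mul0r add0r addr_ge0// addr_ge0 ?invr_ge0//.
  by do 2!(apply: wmean_ge0 => // ? _).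
have nr0 : 0 < n%:R :> R by rewrite ltr0n.
have := growth_rate_le (mcap_ge0 R Gam0) n0; rewrite ler_pdivlMr// mulrC => /le_trans; apply.
apply: (@mcap_le _ _ _ Gam0 Gam_sym _ _ (n.+1%:R * e + m.*2%:R * (n.+1%:R + 1))) => k.
apply: le_trans (mhit_le _ _ m M0) _; rewrite -/e.
rewrite -[k.+1]addn1 -[n.+1]addn1 !natrD; lra.
Qed.

End Intersections.

(** * Intersections of two independent walks *)

Section MeanFinSum.
Variables (R : realType) (G : groupType) (Gam : {fset G}) (K : choiceType).

Lemma fsupp_avg (f : G -> K -> R) : (forall y, fsupp (f y)) ->
  fsupp (fun x => avg Gam (f^~ x)).
Proof. by move=> fs; apply/fsuppMr/fsupp_sum. Qed.

Lemma fsupp_wmean n (f : seq G -> K -> R) : (forall s, fsupp (f s)) ->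
  fsupp (fun x => wmean Gam n (f^~ x)).
Proof.
elim: n f => [|n IHn] f fs /=; first exact: fs.
by apply: fsupp_avg => y; exact: (IHn (fun t => f (y :: t))).
Qed.

Lemma fsum_wmean n (f : seq G -> K -> R) : (forall s, fsupp (f s)) ->
  fsum (fun x => wmean Gam n (f^~ x)) = wmean Gam n (fun s => fsum (f s)).
Proof.
elim: n f => [|n IHn] f fs //=.
rewrite /avg fsumZ fsum_sum; last first.
  by move=> y; exact: (fsupp_wmean n (fun t => fs (y :: t))).
by congr (_ * _); apply: eq_bigr => y _; exact: (IHn (fun t => f (y :: t))).
Qed.

End MeanFinSum.

Section SecondMoment.
Variables (R : realType) (G : groupType) (Gam : {fset G}).
Hypothesis Gam0 : Gam != fset0.
Hypothesis Gam_sym : symmetric_fset Gam.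
Local Notation wmean := (@wmean R G Gam).
Local Notation heat := (@heat R G Gam).
Local Notation pos k s := (gprod (take k s)).
Implicit Types (s t a b : seq G).

(** Local time at [x] over even times; [green] is its mean and [minter] the mean of [inter]. *)
Definition ltime m a x : R := \sum_(k < m) (pos k.*2 a == x)%:R.

Definition green m x : R := \sum_(k < m) heat k.*2 x.

Definition minter m z : R := \sum_(k < m) \sum_(l < m) heat (k.*2 + l.*2)%N z.

Lemma fsupp_ltime m a : fsupp (ltime m a).
Proof.
apply: fsupp_sum => k; have [A HA] := @fsupp_delta R _ (pos k.*2 a).
by exists A => x /HA; rewrite eq_sym.
Qed.

Lemma fsupp_green m : fsupp (green m).
Proof. by apply: fsupp_sum => k; exact: fsupp_heat. Qed.

Lemma ltime_ge0 m a x : 0 <= ltime m a x.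
Proof. exact: sumr_ge0. Qed.

Lemma green_ge0 m x : 0 <= green m x.
Proof. by apply: sumr_ge0 => k _; exact: heat_ge0. Qed.

Lemma interE m z a b : (inter m z a b)%:R = fsum (fun x => ltime m a x * ltime m b (z^-1 * x)%g).
Proof.
have -> : (fun x => ltime m a x * ltime m b (z^-1 * x)%g) = (fun x =>
   \sum_(k < m) (x == pos k.*2 a)%:R * ltime m b (z^-1 * x)%g).
  by apply/funext => x; rewrite -mulr_suml; congr (_ * _); apply: eq_bigr => k _; rewrite eq_sym.
rewrite fsum_sum; last by move=> k; apply/fsuppMl/fsupp_delta.
rewrite /inter -sum1_card natr_sum big_mkcond.
rewrite -(pair_bigA _ (fun k l : 'I_m => if (k, l) \in [pred p : 'I_m * 'I_m | pos p.1.*2 a == (z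
  * pos p.2.*2 b)%g] then 1%:R else 0))/=.
apply: eq_bigr => k _; rewrite fsum_delta; apply: eq_bigr => l _; rewrite inE/=.
rewrite -(inj_eq (@mulgI _ z^-1%g)) mulKg eq_sym.
by case: eqP.
Qed.

Lemma mean_inter m z :
  wmean m.*2 (fun a => wmean m.*2 (fun b => (inter m z a b)%:R)) = minter m z.
Proof.
have H k (f : G -> R) : (k <= m)%N -> wmean m.*2 (fun s => f (pos k.*2 s)) =
    wmean k.*2 (fun s => f (gprod s)).
  move=> km; have := @wmean_pos R G Gam Gam0 Gam_sym m.*2 0 k.*2 f.
  rewrite sub0n subn0 => <- //; last by rewrite leq_double.
  by apply: eq_wmean => s _; rewrite take0 gprod_nil invg1 mul1g.
transitivity (wmean m.*2 (fun a => wmean m.*2 (fun b =>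
   \sum_(k < m) \sum_(l < m) (pos k.*2 a == (z * pos l.*2 b)%g)%:R))).
  apply: eq_wmean => a _; apply: eq_wmean => b _.
  rewrite /inter -sum1_card natr_sum big_mkcond.
  rewrite (pair_bigA _ (fun k l : 'I_m => (pos k.*2 a == (z * pos l.*2 b)%g)%:R))/=.
  by apply: eq_bigr => p _; rewrite inE; case: eqP.
under eq_wmean do rewrite wmean_sum//.
rewrite wmean_sum//; apply: eq_bigr => k _.
under eq_wmean do rewrite wmean_sum//.
rewrite wmean_sum//; apply: eq_bigr => l _.
rewrite wmeanC//.
under eq_wmean do rewrite (H k (fun x => (x == _)%:R) (ltnW (ltn_ord k))) -heatE//.
rewrite (H l (fun x => heat k.*2 (z * x)%g) (ltnW (ltn_ord l))) -iter_mkvE.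
by rewrite addnC /heat iterD.
Qed.

Definition ltime2 m a (p : G * G) : R := ltime m a p.1 * ltime m a p.2.

Definition mean_ltime2 m p : R := wmean m.*2 (fun a => ltime2 m a p).

Lemma fsupp_pair (K L : choiceType) (f : K -> R) (g : L -> R) : fsupp f -> fsupp g ->
  fsupp (fun p : K * L => f p.1 * g p.2).
Proof.
move=> [A fA] [B gB]; exists (A `*` B)%fset => -[x y].
by rewrite inE negb_and => /orP[/fA|/gB] ->; rewrite ?mul0r ?mulr0.
Qed.

Lemma fsupp_ltime2 m a : fsupp (ltime2 m a).
Proof. by apply: fsupp_pair; exact: fsupp_ltime. Qed.

Definition translate2 (z : G) (p : G * G) := (z^-1 * p.1, z^-1 * p.2)%g.

Lemma translate2_bij z : bijective (translate2 z).
Proof.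
by exists (fun p => (z * p.1, z * p.2)%g) => -[x y];
  rewrite /translate2 /= !mulgA ?mulgV ?mulVg !mul1g.
Qed.

Lemma fsupp_translate2 z (f : G * G -> R) : fsupp f -> fsupp (f \o translate2 z).
Proof. by have [h hK _] := translate2_bij z; exact: fsupp_comp hK. Qed.

(* Cauchy-Schwarz over pairs of sites removes the displacement z. *)
Lemma mean_inter_sqr_le m z :
  wmean m.*2 (fun a => wmean m.*2 (fun b => (inter m z a b)%:R ^+ 2)) <=
  fsum (fun p => mean_ltime2 m p ^+ 2).
Proof.
have sM : fsupp (mean_ltime2 m) by apply: fsupp_wmean => a; exact: fsupp_ltime2.
(* The square of a sum over sites is a sum over pairs of sites, and independence of the two walks
   factors each term. *)
have -> : wmean m.*2 (fun a => wmean m.*2 (fun b => (inter m z a b)%:R ^+ 2)) =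
    fsum (fun p => mean_ltime2 m p * mean_ltime2 m (translate2 z p)).
  transitivity (wmean m.*2 (fun a => fsum (fun p => ltime2 m a p * mean_ltime2 m (translate2 z
    p)))).
    apply: eq_wmean => a _.
    transitivity (wmean m.*2 (fun b => fsum (fun p => ltime2 m a p * ltime2 m b (translate2 z p)))).
      apply: eq_wmean => b _; rewrite interE expr2.
      rewrite -fsum_prod; try by apply/fsuppMl/fsupp_ltime.
      by congr fsum; apply/funext => -[x y]; rewrite /ltime2 /=; ring.
    rewrite -fsum_wmean; last by move=> b; apply/fsuppMl/fsupp_ltime2.
    by congr fsum; apply/funext => p; rewrite wmeanZ.
  rewrite -fsum_wmean; last by move=> b; apply/fsuppMl/fsupp_ltime2.
  congr fsum; apply/funext => p; rewrite mulrC -wmeanZ; apply: eq_wmean => a _.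
  by rewrite mulrC.
apply: (@le_trans _ _ (fsum (fun p => 2^-1 * mean_ltime2 m p ^+ 2 + 2^-1 * mean_ltime2 m
  (translate2 z p) ^+ 2))).
  apply: fsum_le => [||p]; first exact: fsuppMl.
    apply: fsuppD; apply: fsuppMr; rewrite ?expr2; first exact: fsuppMl.
    exact/fsuppMl/fsupp_translate2.
  by have := sqr_ge0 (mean_ltime2 m p - mean_ltime2 m (translate2 z p)); lra.
rewrite fsumD ?fsumZ; last 2 first.
- exact/fsuppMr/fsuppMl.
- exact/fsuppMr/fsuppMl/fsupp_translate2.
have /= -> := @reindex_fsum R _ (fun p => mean_ltime2 m p ^+ 2) _ (translate2_bij z).
lra.
Qed.

Lemma sum_shift_le (h : nat -> R) m k : (forall d, 0 <= h d) -> (k < m)%N ->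
  \sum_(k' < m) (k <= k')%N%:R * h (k' - k)%N <= \sum_(d < m) h d.
Proof.
move=> h0 km; rewrite -(big_mkord xpredT (fun k' => (k <= k')%N%:R * h (k' - k)%N)).
rewrite -(big_mkord xpredT h) (@big_cat_nat _ _ _ k)//=; last exact: ltnW.
rewrite big_nat big1 ?add0r; last first.
  by move=> s /andP[_ sk]; rewrite leqNgt sk mul0r.
rewrite -{1}(add0n k) big_addn.
apply: (@le_trans _ _ (\sum_(0 <= d < m - k) h d)).
  by apply: ler_sum => d _; rewrite leq_addl mul1r addnK.
by rewrite [leRHS](@big_cat_nat _ _ _ (m - k))//= ?leq_subr// ler_wpDr// sumr_ge0.
Qed.

Definition green2 m (p : G * G) : R := green m p.1 * green m (p.1^-1 * p.2)%g.

Lemma green2_ge0 m p : 0 <= green2 m p.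
Proof. by rewrite mulr_ge0// green_ge0. Qed.

(** Order the visits to the two sites: the walk reaches the first, then makes the displacement to
    the second. *)
Lemma mean_ltime2_le m p : mean_ltime2 m p <= green2 m p + green2 m (p.2, p.1).
Proof.
case: p => x y; rewrite /mean_ltime2 /ltime2 /=.
pose J (i j : nat) x y : R := heat i.*2 x * heat j.*2 (x^-1 * y)%g.
have Jsum x' y' : \sum_(k < m) \sum_(k' < m) (k <= k')%N%:R * J k (k' - k)%N x' y' <=
    green2 m (x', y').
  rewrite /green2 /= {1}/green mulr_suml; apply: ler_sum => k _.
  rewrite mulr_sumr; apply: (sum_shift_le (h := fun d => J k d x' y')) => // d.
  by rewrite mulr_ge0// heat_ge0.
have Jpos (k k' : 'I_m) x' y' : (k <= k')%N ->
   wmean m.*2 (fun a => (pos k.*2 a == x')%:R * (pos k'.*2 a == y')%:R) = J k (k' - k)%N x' y'.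
  move=> kk'; have := @wmean_pos2 R G Gam Gam0 m.*2 k.*2 k'.*2
    (fun u v => (u == x')%:R * (v == y')%:R).
  rewrite leq_double kk' leq_double (ltnW (ltn_ord k')) => -> //.
  rewrite /J -doubleB !heatE// mulrC -wmeanZ; apply: eq_wmean => s _.
  rewrite mulrC -wmeanZ; apply: eq_wmean => t _.
  case: eqP => [->|_]; last by rewrite !mul0r.
  by rewrite -[in RHS](inj_eq (@mulgI _ x')) mulVKg.
under eq_wmean do rewrite /ltime big_distrlr.
rewrite wmean_sum//; under eq_bigr do rewrite wmean_sum//.
apply: le_trans (lerD (Jsum x y) (Jsum y x)).
rewrite [X in _ <= _ + X]exchange_big -big_split/=; apply: ler_sum => k _.
rewrite -big_split/=; apply: ler_sum => k' _.
have J0 i j x' y' : 0 <= J i j x' y' by rewrite mulr_ge0// heat_ge0.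
have [kk'|/ltnW k'k] := leqP k k'.
  by rewrite mul1r Jpos// ler_wpDr// mulr_ge0.
under eq_wmean do rewrite mulrC.
by rewrite k'k mul1r Jpos// ler_wpDl// mulr_ge0.
Qed.

Lemma fsum_green_sqr m : fsum (fun x => green m x ^+ 2) = minter m 1%g.
Proof.
have -> : (fun x => green m x ^+ 2) = (fun x => \sum_(k < m) \sum_(l < m) heat k.*2 x * heat l.*2
  x).
  by apply/funext => x; rewrite expr2 big_distrlr.
rewrite fsum_sum => [|k]; last by apply: fsupp_sum => l; exact/fsuppMl/fsupp_heat.
apply: eq_bigr => k _; rewrite fsum_sum => [|l]; last exact/fsuppMl/fsupp_heat.
apply: eq_bigr => l _; rewrite heatD//; congr fsum; apply/funext => x.
by rewrite invg1 mul1g.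
Qed.

(** The two orders of visit each contribute, after (v + w)^2 <= 2 v^2 + 2 w^2, twice the squared
    mean; shearing the pair of sites makes the sum of [green2 ^+ 2] a product. *)
Lemma mean_inter_sqr m z :
  wmean m.*2 (fun a => wmean m.*2 (fun b => (inter m z a b)%:R ^+ 2)) <=
  4 * minter m 1%g ^+ 2.
Proof.
apply: le_trans (mean_inter_sqr_le m z) _.
pose shear (p : G * G) : G * G := (p.1, p.1 * p.2)%g.
pose unshear (p : G * G) : G * G := (p.1, p.1^-1 * p.2)%g.
have shearK : cancel shear unshear by move=> [x y]; rewrite /shear /unshear /= mulKg.
have unshearK : cancel unshear shear by move=> [x y]; rewrite /shear /unshear /= mulVKg.
have shear_bij : bijective shear by exists unshear.
have swap_bij : bijective (fun p : G * G => (p.2, p.1)) by exists (fun p => (p.2, p.1)) => -[].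
have sg2 : fsupp (fun p => green2 m p ^+ 2).
  have sg : fsupp (fun p : G * G => green m p.1 ^+ 2 * green m p.2 ^+ 2).
    by apply: (fsupp_pair (f := fun x => green m x ^+ 2) (g := fun x => green m x ^+ 2));
      exact: (fsuppMl (green m) (fsupp_green m)).
  have := fsupp_comp unshearK sg; congr fsupp.
  by apply/funext => p /=; rewrite -exprMn.
have sg2' : fsupp (fun p => green2 m (p.2, p.1) ^+ 2).
  by apply: (fsupp_comp (h := fun p : G * G => (p.2, p.1)) (k := fun p : G * G => (p.2, p.1)) _
    sg2) => -[].
have E : fsum (fun p => green2 m p ^+ 2) = minter m 1%g ^+ 2.
  rewrite -(reindex_fsum _ shear_bij) -fsum_green_sqr [RHS]expr2 -fsum_prod; last 2 first.
  - exact: (fsuppMl (green m) (fsupp_green m)).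
  - exact: (fsuppMl (green m) (fsupp_green m)).
  by congr fsum; apply/funext => -[x y] /=; rewrite /green2 /= mulKg exprMn.
have E' : fsum (fun p => green2 m (p.2, p.1) ^+ 2) = minter m 1%g ^+ 2.
  by rewrite -E -(reindex_fsum _ swap_bij).
apply: (@le_trans _ _ (fsum (fun p => 2 * green2 m p ^+ 2 + 2 * green2 m (p.2, p.1) ^+ 2))).
  apply: fsum_le => [||p].
  - apply: (fsuppMl (mean_ltime2 m)); apply: fsupp_wmean => a; exact: fsupp_ltime2.
  - by apply: fsuppD; exact: fsuppMr.
  have : 0 <= mean_ltime2 m p.
    by apply: wmean_ge0 => // a _; rewrite mulr_ge0 ?ltime_ge0.
  have := mean_ltime2_le m p; have := green2_ge0 m p; have := green2_ge0 m (p.2, p.1).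
  move: (mean_ltime2 m p) (green2 m p) (green2 m (p.2, p.1)) => u v w v0 w0 uvw u0.
  have : u ^+ 2 <= (v + w) ^+ 2 by rewrite ler_pXn2r// nnegrE addr_ge0.
  have := sqr_ge0 (v - w); lra.
rewrite fsumD ?fsumZ ?E ?E'; [lra|exact: fsuppMr|exact: fsuppMr].
Qed.

End SecondMoment.

(** * Restarting, and vanishing of the rate when the series diverges *)

Section FewIntersections.
Variables (R : realType) (G : groupType) (Gam : {fset G}).
Hypothesis Gam0 : Gam != fset0.
Hypothesis Gam_sym : symmetric_fset Gam.
Local Notation wmean := (@wmean R G Gam).
Local Notation ret := (@ret R G Gam).
Local Notation mcap := (@mcap R G Gam).
Local Notation minter := (@minter R G Gam).
Local Notation few := (@few R G Gam).
Implicit Types (s t a b : seq G).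

Lemma ret_le1 n : ret n <= 1.
Proof.
rewrite /ret heatE// -[leRHS](wmean_cst Gam0 (n + n)); apply: le_wmean => t _.
by rewrite -[leRHS]/(1%:R) ler_nat leq_b1.
Qed.

Lemma minter1E m : minter m 1%g = \sum_(k < m) \sum_(l < m) ret (k + l)%N.
Proof.
apply: eq_bigr => k _; apply: eq_bigr => l _; rewrite /ret -!addnn.
by rewrite (addnACA k k l l).
Qed.

(** For s < m all s + 1 pairs with sum s occur in the double sum. *)
Lemma minter1_ge m : \sum_(s < m) s.+1%:R * ret s <= minter m 1%g.
Proof.
have r0 k : 0 <= ret k by exact: ret_ge0.
rewrite minter1E.
apply: (@le_trans _ _ (\sum_(k < m) \sum_(s < m) (k <= s)%N%:R * ret s)).
  rewrite exchange_big; apply: ler_sum => s _ /=; rewrite -mulr_suml ler_wpM2r//.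
  rewrite (bigID (fun k : 'I_m => (k <= s)%N))/= ler_wpDr ?sumr_ge0//.
  under eq_bigr => k -> do [].
  rewrite sumr_const ler_nat -(card_ord s.+1).
  have sm k : (k < s.+1 -> k < m)%N by have := ltn_ord s; lia.
  rewrite -(@fintype.card_image _ _ (fun k : 'I_s.+1 => Ordinal (sm k (ltn_ord k)))); last first.
    by move=> k k' /(congr1 val)/= /val_inj.
  apply: subset_leq_card; apply/fintype.subsetP => q /fintype.imageP[k _ ->].
  by rewrite -[_ \in _]/((k <= s)%N) -ltnS.
apply: ler_sum => k _.
rewrite -(big_mkord xpredT (fun i => (k <= i)%N%:R * ret i)) (@big_cat_nat _ _ _ k)//=;
  last exact: ltnW.
rewrite big_nat big1 ?add0r; last first.
  by move=> s /andP[_ sk]; rewrite leqNgt sk mul0r.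
rewrite -{1}(add0n (k : nat)) big_addn.
rewrite -(big_mkord xpredT (fun l => ret (k + l)%N)) [leRHS](@big_cat_nat _ _ _ (m - k))//=
  ?leq_subr//.
rewrite ler_wpDr ?sumr_ge0//; apply: ler_sum => d _.
by rewrite leq_addl mul1r addnC.
Qed.

(** The right side of the pseudo-Poincare inequality telescopes in l. *)
Lemma minter_shift_le m r s : word Gam r.*2 s ->
  minter m 1%g - minter m (gprod s) <=
  r%:R ^+ 2 * #|` Gam|%:R ^+ 2 * \sum_(k < m) ret k.
Proof.
move=> sw; set c := _ * _ ^+ 2; have c0 : 0 <= c by rewrite mulr_ge0 ?sqr_ge0.
have r0 k : 0 <= ret k by exact: ret_ge0.
rewrite minter1E /minter -sumrB mulr_sumr; apply: ler_sum => k _.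
rewrite -sumrB; apply: (@le_trans _ _ (\sum_(l < m) c * (ret (k + l)%N - ret (k + l).+1))).
  apply: ler_sum => l _; rewrite -!addnn (addnACA k k l l).
  exact: ret_shift_le.
rewrite -mulr_sumr ler_wpM2l//.
rewrite -(big_mkord xpredT (fun l => ret (k + l)%N - ret (k + l).+1)).
under eq_bigr do rewrite -addnS.
rewrite (telescope_sumr_eq (fun l => - ret (k + l)%N))//; last by move=> i _; ring.
by rewrite addn0; have := r0 (k + m)%N; lra.
Qed.

Hypothesis div : forall B : R, exists L, B <= \sum_(s < L) s.+1%:R * ret s.

(** By divergence the series with weights k + 1 dwarfs the unweighted one, so a fixed displacement
    becomes negligible. *)
Lemma minter_dominates (c B : R) : 0 <= c ->
  exists m, B <= minter m 1%g /\ c * (\sum_(k < m) ret k) <= minter m 1%g / 2.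
Proof.
move=> c0; have r0 k : 0 <= ret k by exact: ret_ge0.
(* From index J on the weight k + 1 exceeds 4 c; the earlier terms contribute at most c J, as [ret]
   is at most 1. *)
pose J := (Num.bound (4 * c)); have JP : 4 * c <= J%:R.
  by rewrite ltW// archi_boundP// mulr_ge0.
have [m mP] := div (Num.max B (4 * (c * J%:R))).
exists m; have := minter1_ge m; have := mP; rewrite ge_max => /andP[h1 h2] h3; split; first lra.
suff : c * (\sum_(k < m) ret k) <= c * J%:R + (\sum_(s < m) s.+1%:R * ret s) / 4 by lra.
rewrite mulr_sumr mulr_suml.
apply: (@le_trans _ _ (\sum_(k < m) (c * (k < J)%N%:R + k.+1%:R * ret k / 4))).
  apply: ler_sum => k _; have [kJ|Jk] := ltnP k J.
    rewrite mulr1; have := ler_wpM2l c0 (ret_le1 k).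
    have : 0 <= k.+1%:R * ret k by rewrite mulr_ge0.
    lra.
  rewrite mulr0 add0r; have : 4 * c <= k.+1%:R.
    by apply: le_trans JP _; rewrite ler_nat leqW.
  have := r0 k; nra.
rewrite big_split lerD// -mulr_sumr ler_wpM2l//.
suff : forall N, \sum_(j < N) (j < J)%N%:R <= (minn N J)%:R :> R.
  by move=> /(_ m)/le_trans; apply; rewrite ler_nat geq_minr.
elim=> [|N IHN]; first by rewrite big_ord0 ler0n.
rewrite big_ord_recr/=; apply: le_trans (lerD IHN (lexx _)) _.
by rewrite -natrD ler_nat; lia.
Qed.

(* Paley-Zygmund, in the form x <= M + 8 F 1_(x >= M) + x^2 / (32 F). *)
Lemma few_le m M z : 0 < minter m 1%g -> 4 * M%:R <= minter m 1%g ->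
  minter m 1%g / 2 <= minter m z -> few m M z <= 63 / 64.
Proof.
set F := minter m 1%g => F0 MF Fz.
pose E2 (f : seq G -> seq G -> R) := wmean m.*2 (fun a => wmean m.*2 (f a)).
have E2l (f g : seq G -> seq G -> R) : (forall a b, f a b <= g a b) -> E2 f <= E2 g.
  by move=> fg; apply: le_wmean => a _; apply: le_wmean => b _.
have E2D (f g : seq G -> seq G -> R) : E2 (fun a b => f a b + g a b) = E2 f + E2 g.
  by rewrite /E2 -wmeanD; apply: eq_wmean => a _; rewrite wmeanD.
have E2Z c (f : seq G -> seq G -> R) : E2 (fun a b => c * f a b) = c * E2 f.
  by rewrite /E2 -wmeanZ; apply: eq_wmean => a _; rewrite wmeanZ.
have E2c c : E2 (fun _ _ => c) = c by rewrite /E2 !wmean_cst.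
have H1 : E2 (fun a b => (inter m z a b)%:R) = minter m z by exact: mean_inter.
have H2 : E2 (fun a b => (inter m z a b)%:R ^+ 2) <= 4 * F ^+ 2 by exact: mean_inter_sqr.
rewrite -[few m M z]/(E2 (fun a b => (inter m z a b < M)%N%:R)); set q := E2 _.
have : minter m z <= M%:R + (1 / (32 * F)) * (4 * F ^+ 2) + 8 * F * (1 - q).
  rewrite -H1; apply: (@le_trans _ _ (E2 (fun a b =>
     (M%:R + 8 * F) + ((1 / (32 * F)) * (inter m z a b)%:R ^+ 2 +
       (- (8 * F)) * (inter m z a b < M)%N%:R)))); last first.
    rewrite E2D E2c E2D !E2Z -/q.
    have : 1 / (32 * F) * E2 (fun a b => (inter m z a b)%:R ^+ 2) <= 1 / (32 * F) * (4 * F ^+ 2).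
      by rewrite ler_wpM2l// divr_ge0// mulr_ge0// ltW.
    lra.
  apply: E2l => a b; set x := inter m z a b.
  have x2 : 0 <= 1 / (32 * F) * x%:R ^+ 2.
    by rewrite mulr_ge0 ?sqr_ge0// divr_ge0// mulr_ge0// ltW.
  have [xM|Mx] := ltnP x M.
    rewrite mulr1; have : x%:R <= M%:R :> R by rewrite ler_nat ltnW.
    lra.
  have : x%:R <= 8 * F + 1 / (32 * F) * x%:R ^+ 2.
    have e : 1 / (32 * F) * x%:R ^+ 2 = (x%:R / (16 * F)) * (x%:R / 2).
      field; lra.
    pose y := x%:R / (16 * F); have xy : x%:R = y * (16 * F).
      by rewrite /y mulfVK// gt_eqF// mulr_gt0.
    rewrite e -/y xy; have := sqr_ge0 (y - 1); nra.
  by rewrite mulr0; have : 0 <= M%:R :> R by []; lra.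
(* With F / 2 on the left and M at most F / 4, this leaves F / 8 <= 8 F (1 - q), that is q <= 63 /
   64. *)
have -> : 1 / (32 * F) * (4 * F ^+ 2) = F / 8 by field; lra.
nra.
Qed.

(* After 2n steps the walks are apart by z, which by minter_shift_le does not affect
   the leading order of the mean number of further intersections. *)
Lemma few_restart n M : exists m, few (n + m) M 1%g <= 63 / 64 * few n M 1%g.
Proof.
pose c : R := (n.*2)%:R ^+ 2 * #|` Gam|%:R ^+ 2.
have c0 : 0 <= c by rewrite mulr_ge0 ?sqr_ge0.
have [m [mB mc]] := minter_dominates (Num.max 1 (4 * M%:R)) c0.
move: mB; rewrite ge_max => /andP[F1 FM].
exists m; rewrite -wmeanZ {1}/few doubleD wmean_cat; apply: le_wmean => s /andP[/eqP ss sG].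
rewrite -wmeanZ; under eq_wmean do rewrite wmean_cat.
rewrite wmeanC//; apply: le_wmean => t /andP[/eqP st tG].
pose z := gprod (inv_word s ++ t).
have zw : word Gam n.*2.*2 (inv_word s ++ t).
  rewrite /word size_cat size_inv_word ss st addnn eqxx all_cat tG andbT.
  rewrite /inv_word all_rev all_map; apply/allP => x xs /=.
  by rewrite memV//; exact: (allP sG).
(* Fewer than M meetings in all means fewer than M both before and after the restart. *)
apply: (@le_trans _ _ (wmean m.*2 (fun a => wmean m.*2 (fun b =>
   (inter n 1 s t < M)%N%:R * (inter m z a b < M)%N%:R)))).
  apply: le_wmean => a _; apply: le_wmean => b _; rewrite -natrM ler_nat mulnb.
  case: (ltnP (inter (n + m) 1 (s ++ a) (t ++ b)) M) => // h.
  have i1 : (inter n 1 s t <= inter (n + m) 1 (s ++ a) (t ++ b))%N.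
    rewrite /inter -(@fintype.card_image _ _ (fun p : 'I_n * 'I_n => (lshift m p.1, lshift m
      p.2))); last first.
      by move=> [x y] [x' y'] [/= /val_inj -> /val_inj ->].
    apply: subset_leq_card; apply/fintype.subsetP => q /fintype.imageP[[x y]].
    rewrite !inE /= => /eqP E ->.
    by rewrite /= !takel_cat ?ss ?st ?leq_double ?(ltnW (ltn_ord _))// E.
  have i2 : (inter m z a b <= inter (n + m) 1 (s ++ a) (t ++ b))%N.
    rewrite /inter -(@fintype.card_image _ _ (fun p : 'I_m * 'I_m => (rshift n p.1, rshift n
      p.2))); last first.
      by move=> [x y] [x' y'] [/= /addnI/val_inj -> /addnI/val_inj ->].
    apply: subset_leq_card; apply/fintype.subsetP => q /fintype.imageP[[x y]].
    rewrite !inE /= => /eqP E ->; rewrite /= !doubleD.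
    rewrite -{1}ss -{1}st !take_cat !ltnNge !leq_addr /= !addKn !gprod_cat E.
    by rewrite /z gprod_cat gprod_inv_word mul1g -!mulgA mulVKg.
  by rewrite (leq_ltn_trans i1 h) (leq_ltn_trans i2 h).
rewrite -[leLHS]/(wmean _ (fun a => wmean _ (fun b => _ * _))).
under eq_wmean do rewrite wmeanZ.
rewrite wmeanZ mulrC ler_wpM2r// -/(few m M z).
apply: few_le => //; first lra.
have := minter_shift_le m zw; rewrite -/z -/c; lra.
Qed.

Lemma few_small M j : exists n, few n M 1%g <= (63 / 64) ^+ j.
Proof.
elim: j => [|j [n IHj]].
  exists 0%N; rewrite expr0 -[leRHS](wmean_cst Gam0 0.*2); apply: le_wmean => a _.
  rewrite -[leRHS](wmean_cst Gam0 0.*2); apply: le_wmean => b _.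
  by rewrite -[leRHS]/(1%:R) ler_nat leq_b1.
have [m mP] := few_restart n M; exists (n + m)%N; apply: le_trans mP _.
by rewrite exprS ler_pM2l//; lra.
Qed.

Lemma growth_rate_eq0 : growth_rate mcap = 0.
Proof.
apply/eqP; rewrite eq_le growth_rate_ge0; last exact: mcap_ge0.
rewrite andbT; apply/ler_addgt0Pl => e e0; rewrite addr0.
have e2 : 0 < e / 2 by lra.
have [M MP] : exists M : nat, (e / 2)^-1 < M.+1%:R.
  exists (Num.bound `|(e / 2)^-1|).
  apply: lt_le_trans (_ : (Num.bound `|(e / 2)^-1|)%:R <= _); last by rewrite ler_nat.
  exact: le_lt_trans (ler_norm _) (archi_boundP (normr_ge0 _)).
have [j jP] : exists j, (63 / 64 : R) ^+ j < e / 2.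
  have /cvgrPdist_lt/(_ _ e2)[j _ /(_ j (leqnn _))] :
      (fun j => (63 / 64 : R) ^+ j) @ \oo --> 0.
    by apply: cvg_expr; rewrite ger0_norm; lra.
  rewrite /= sub0r normrN ger0_norm ?exprn_ge0 //.
  by exists j.
have [n nP] := few_small M.+1 j.
have := growth_rate_le_few R Gam0 Gam_sym n (ltn0Sn M).
have : M.+1%:R^-1 < e / 2 by rewrite invf_plt ?posrE// ltr0n.
move=> h1 /le_trans; apply; rewrite [e]splitr lerD ?(ltW h1)//.
exact: le_trans nP (ltW jP).
Qed.

End FewIntersections.

(** * Return probabilities and volume growth *)

Section Balls.
Variables (R : realType) (G : groupType) (Gam : {fset G}).

Definition ball_set n : set G := [set g : G | (word_length R Gam g <= n%:R%:E)%E].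

Lemma ball_setP n g : ball_set n g <-> exists2 k, (k <= n)%N & g \in wordset Gam k.
Proof.
split=> [gn|[k kn /is_wordE gk]]; last first.
  apply: (@le_trans _ _ k%:R%:E); last by rewrite lee_fin ler_nat.
  by apply: ereal_inf_lbound; exists k.
apply: contrapT => H.
have : (n.+1%:R%:E <= word_length R Gam g)%E.
  apply: le_ereal_inf_tmp => _ [k /is_wordE gk <-]; rewrite lee_fin ler_nat ltnNge.
  by apply/negP => kn; apply: H; exists k.
by move=> /le_trans/(_ gn); rewrite lee_fin ler_nat ltnn.
Qed.

Lemma finite_ball n : finite_set (ball_set n).
Proof.
apply: (@sub_finite_set _ _ (\bigcup_(k in `I_n.+1) [set` wordset Gam k])).
  by move=> g /ball_setP[k kn gk]; exists k.
by apply: bigcup_finite.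
Qed.

Definition gball n : {fset G} := fset_set (ball_set n).

Lemma gballP n g : reflect (exists2 k, (k <= n)%N & g \in wordset Gam k) (g \in gball n).
Proof.
rewrite in_fset_set; last exact: finite_ball.
by apply: (iffP idP) => [/set_mem/ball_setP|/ball_setP/mem_set].
Qed.

Lemma volumeE n : volume R Gam n = #|` gball n|.
Proof. by []. Qed.

Lemma gballS m n : (m <= n)%N -> (gball m `<=` gball n)%fset.
Proof.
move=> mn; apply/fsubsetP => g /gballP[k km gk]; apply/gballP; exists k => //.
exact: leq_trans mn.
Qed.

Lemma wordset_mulr n g x : g \in wordset Gam n -> x \in Gam -> (g * x)%g \in wordset Gam n.+1.
Proof.
move=> /wordsetP[s /andP[sn sG] ->] xG; apply/wordsetP; exists (rcons s x).
  by rewrite /word size_rcons eqSS sn all_rcons /= xG.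
by rewrite gprod_rcons.
Qed.

Lemma gball_mulr n g x : g \in gball n -> x \in Gam -> (g * x)%g \in gball n.+1.
Proof.
by move=> /gballP[k kn gk] xG; apply/gballP; exists k.+1 => //; exact: wordset_mulr.
Qed.

Hypothesis Gam0 : Gam != fset0.
Hypothesis Gam_sym : symmetric_fset Gam.

Lemma wordset_pad n k g : g \in wordset Gam n -> g \in wordset Gam (n + k.*2).
Proof.
move=> gn; elim: k => [|k IHk]; first by rewrite addn0.
have /fset0Pn[x xG] := Gam0.
rewrite doubleS !addnS -(mulgK x g); apply: wordset_mulr; last by rewrite memV.
exact: wordset_mulr.
Qed.

(** Words of even length are padded by cancelling pairs; those of odd length first get one extra
    letter, hence two copies of the word set and the radius 2r - 1. *)
Lemma volume_even_le r : (0 < r)%N -> (volume R Gam r.*2.-1 <= 2 * #|` wordset Gam r.*2|)%N.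
Proof.
move=> r0; have /fset0Pn[x xG] := Gam0.
have sub : (gball r.*2.-1 `<=` wordset Gam r.*2 `|` [fset y * x^-1 | y in wordset Gam r.*2]%g)%fset.
  apply/fsubsetP => g /gballP[k kr gk]; rewrite inE; apply/orP.
  have := odd_double_half k; case: (odd k) => kE; [right|left].
    apply/imfsetP; exists (g * x)%g => /=; last by rewrite mulgK.
    have := wordset_pad (r - (k./2).+1) (wordset_mulr gk xG).
    by rewrite (_ : (_ + _ = r.*2)%N)//; lia.
  have := wordset_pad (r - k./2) gk.
  by rewrite (_ : (_ + _ = r.*2)%N)//; lia.
rewrite volumeE; apply: leq_trans (fsubset_leq_card sub) _.
rewrite mulSn mul1n cardfsU; apply: leq_trans (leq_subr _ _) _.
by rewrite leq_add2l; apply: leq_imfset_card.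
Qed.

End Balls.

Lemma volume_fset0 (R : realType) (G : groupType) n : (volume R (fset0 : {fset G}) n <= 1)%N.
Proof.
rewrite volumeE -(cardfs1 (1 : G)%g); apply: fsubset_leq_card; apply/fsubsetP => g.
move=> /gballP[[|k] _] //= /imfset2P[x /=]; by rewrite inE.
Qed.

Section SumBounds.
Variable R : realType.

Lemma sum_inv_sqrt3_le L :
  \sum_(n < L) (Num.sqrt n.+1%:R ^+ 3)^-1 <= 6 :> R.
Proof.
pose s (n : nat) : R := Num.sqrt n%:R.
have s0 n : 0 < s n.+1 by rewrite sqrtr_gt0 ltr0n.
have s1 n : 1 <= s n.+1 by rewrite -[leLHS]sqrtr1 ler_sqrt// ler1n.
have ss n : s n ^+ 2 = n%:R by rewrite sqr_sqrtr.
(* Comparison with a telescoping sum of differences of inverse square roots. *)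
suff : \sum_(n < L) (s n.+1 ^+ 3)^-1 <= 6 * (1 - (s L.+1)^-1).
  by move/le_trans; apply; have : 0 <= (s L.+1)^-1; [rewrite invr_ge0 ltW|lra].
elim: L => [|L IHL].
  by rewrite big_ord0 /s sqrtr1 invr1 subrr mulr0.
rewrite big_ord_recr/=; apply: le_trans (lerD IHL (lexx _)) _.
set a := s L.+1; set b := s L.+2.
suff : (a ^+ 3)^-1 <= 6 * (a^-1 - b^-1) by lra.
have a0 : 0 < a := s0 _. have b0 : 0 < b := s0 _. have a1 : 1 <= a := s1 _.
have ab : b ^+ 2 = a ^+ 2 + 1 by rewrite !ss -[L.+2]addn1 natrD.
have ba : a < b by rewrite -(ltr_pXn2r (n := 2))// ?nnegrE ?ltW//; lra.
have b2a : b <= 2 * a.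
  rewrite -(ler_pXn2r (n := 2))// ?nnegrE ?ltW ?mulr_gt0// ab exprMn; nra.
have an0 : a != 0 by rewrite gt_eqF.
have bn0 : b != 0 by rewrite gt_eqF.
have H1 : 1 <= (b - a) * (3 * a).
  have E : (b - a) * (b + a) = 1 by rewrite -subr_sqr ab; ring.
  apply: (@le_trans _ _ ((b - a) * (b + a))); first by rewrite E.
  rewrite ler_pM2l ?subr_gt0//; lra.
rewrite -(@ler_pM2r _ (a ^+ 3 * b)) ?mulr_gt0 ?exprn_gt0//.
have -> : (a ^+ 3)^-1 * (a ^+ 3 * b) = b by rewrite mulKf// expf_neq0.
have -> : 6 * (a^-1 - b^-1) * (a ^+ 3 * b) = 2 * a * ((b - a) * (3 * a)).
  by field; rewrite an0 bn0.
by apply: le_trans b2a _; rewrite ler_peMr// mulr_ge0// ltW.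
Qed.

Lemma sum_weighted_decr (u : nat -> R) L : (forall n, 0 <= u n) ->
  \sum_(n < L) (n.+1 * n)%:R * (u n - u n.+1) <= 2 * \sum_(n < L) n.+1%:R * u n.
Proof.
move=> u0.
(* Summation by parts with its boundary term kept; the weights n (n + 1) have increments 2 n. *)
suff : \sum_(n < L) (n.+1 * n)%:R * (u n - u n.+1) + (L * L.-1)%:R * u L <=
    2 * \sum_(n < L) n.+1%:R * u n.
  by apply: le_trans; rewrite ler_wpDr// mulr_ge0.
elim: L => [|L IHL]; first by rewrite !big_ord0 mul0r addr0 mulr0.
rewrite !big_ord_recr/= mulrDr; have := u0 L; have := IHL.
case: L {IHL} => [|L] /=; first by rewrite !muln0 !mul0r; lra.
rewrite !natrM -[L.+2]addn1 -[L.+1]addn1 !natrD.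
have : 0 <= L%:R :> R by []; move: (\sum_(_ < _) _) (\sum_(_ < _) _) => x y.
nra.
Qed.

Lemma sqrt_bracket p n : (0 < p)%N -> exists r, (p ^ 2 * r ^ 2 <= n < p ^ 2 * r.+1 ^ 2)%N.
Proof.
move=> p0; elim: n => [|n [r /andP[rn nr]]].
  by exists 0%N; rewrite exp0n// muln0 leq0n muln_gt0 !expn_gt0 p0.
have [h|h] := ltnP n.+1 (p ^ 2 * r.+1 ^ 2); first by exists r; rewrite h ltnW.
exists r.+1; rewrite h /=; apply: leq_ltn_trans nr _.
by rewrite ltn_pmul2l ?expn_gt0 ?p0// ltn_exp2r.
Qed.

Lemma sqrt_ceil n : (0 < n)%N -> exists j, (n <= j ^ 2 <= 4 * n)%N.
Proof.
case: n => // n _; elim: n => [|n [j /andP[nj jn]]]; first by exists 1%N.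
have [h|h] := leqP n.+2 (j ^ 2); first by exists j; rewrite h /=; lia.
exists j.+1; rewrite !expnS !expn0 in nj jn h *; apply/andP; split; nia.
Qed.

Lemma harmonic_unbounded (B : R) : exists L, B <= \sum_(n < L) n.+1%:R^-1.
Proof.
apply: contrapT => /forallNP H; apply: (@dvg_harmonic R).
apply: nondecreasing_is_cvgn.
  apply/nondecreasing_seqP => n; rewrite /series /= big_nat_recr//= lerDl.
  by rewrite invr_ge0.
exists B => _ [n _ <-]; rewrite /series /= big_mkord ltW// ltNge.
by apply/negP; exact: H.
Qed.

End SumBounds.

(** * Convergence of the series for volume at least of order n^5 *)

Section ReturnUpper.
Variables (R : realType) (G : groupType) (Gam : {fset G}).
Hypothesis Gam0 : Gam != fset0.
Hypothesis Gam_sym : symmetric_fset Gam.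
Local Notation ret := (@ret R G Gam).
Local Notation g := (#|` Gam|%:R : R).

(** Average [ret_shift_le] over the word set; as the heat kernel has mass 1, its mean there is at
    most the inverse cardinality. *)
Lemma ret_nash n r :
  ret n <= (#|` wordset Gam r.*2|%:R)^-1 + r%:R ^+ 2 * g ^+ 2 * (ret n - ret n.+1).
Proof.
set W := wordset _ _.
have W0 : 0 < #|` W|%:R :> R.
  rewrite ltr0n cardfs_gt0; apply/fset0Pn; exists 1%g.
  by have := wordset_pad Gam0 Gam_sym r (_ : 1%g \in wordset Gam 0); rewrite add0n; apply;
    rewrite inE.
have : \sum_(y <- W) heat R Gam (n + n) y <= 1.
  rewrite -(fsum_heat R Gam0 (n + n)).
  have [A HA] := fsupp_heat R Gam (n + n).
  rewrite (@fsumE _ _ _ (A `|` W)%fset); last first.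
    by move=> x; rewrite inE negb_or => /andP[/HA].
  rewrite [leRHS](big_fsetID _ (mem W))/=.
  rewrite (_ : [fset x in _ | _]%fset = W); last first.
    by apply/fsetP => x; rewrite !inE /=; case: (x \in W); rewrite ?orbT ?andbF.
  by rewrite ler_wpDr// sumr_ge0// => x _; exact: heat_ge0.
set D := r%:R ^+ 2 * _ * _.
have : \sum_(y <- W) (ret n - D) <= \sum_(y <- W) heat R Gam (n + n) y.
  rewrite big_seq [leRHS]big_seq; apply: ler_sum => y /wordsetP[s sw ->].
  by have := ret_shift_le R Gam0 Gam_sym n sw; rewrite -/D; lra.
rewrite big_const_seq count_predT iter_addr_0 -[(ret n - D) *+ _]mulr_natl => H1 H2.
have : ret n - D <= (#|` W|%:R)^-1.
  by rewrite -div1r ler_pdivlMr// mulrC; exact: le_trans H1 H2.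
lra.
Qed.

Lemma wordset_card_ge (c : R) : 0 < c ->
  (forall n, (1 <= n)%N -> c * n%:R ^+ 5 <= (volume R Gam n)%:R) ->
  exists2 c' : R, 0 < c' & forall r, c' * r.+1%:R ^+ 5 <= #|` wordset Gam r.*2|%:R.
Proof.
move=> c0 Hc; exists (Num.min 1 (c / 64)).
  by rewrite lt_min ltr01 divr_gt0.
case=> [|r].
  rewrite expr1n mulr1 ge_min; apply/orP; left => /=; by rewrite cardfs1.
have r1 : (0 < r.+1)%N by [].
have := volume_even_le R Gam0 Gam_sym r1; rewrite -(ler_nat R) natrM => H.
have n1 : (1 <= (r.+1).*2.-1)%N by lia.
have := Hc _ n1; move=> /le_trans/(_ H) {}H.
have : r.+2%:R <= 2 * (r.+1).*2.-1%:R :> R by rewrite -natrM ler_nat; lia.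
move=> h; have h5 : r.+2%:R ^+ 5 <= (2 * (r.+1).*2.-1%:R) ^+ 5 :> R.
  by rewrite ler_pXn2r ?nnegrE ?mulr_ge0.
apply: (@le_trans _ _ (c / 64 * r.+2%:R ^+ 5)).
  by rewrite ler_wpM2r ?exprn_ge0// ge_min lexx orbT.
rewrite exprMn in h5; move: H h5; set x := _ ^+ 5; set y := _ ^+ 5 => H h5.
have : c / 64 * y <= c / 64 * (2 ^+ 5 * x) by rewrite ler_wpM2l ?divr_ge0 ?(ltW c0).
lra.
Qed.

(* Summing ret_nash against n, with r ~ sqrt n, and absorbing the gradient term by
   summation by parts. *)
Lemma ret_summable (c : R) : 0 < c ->
  (forall n, (1 <= n)%N -> c * n%:R ^+ 5 <= (volume R Gam n)%:R) ->
  exists2 K : R, 0 < K & forall L, \sum_(s < L) s.+1%:R * ret s <= K.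
Proof.
move=> c0 /(wordset_card_ge c0)[c' c'0 Hc'].
(* Taking r of order sqrt n / p gives the gradient term the coefficient 1/4. *)
pose p := (2 * #|` Gam|)%N; have p0 : (0 < p)%N by rewrite muln_gt0 /= cardfs_gt0.
have pr0 : 0 < p%:R :> R by rewrite ltr0n.
have u0 k : 0 <= ret k by exact: ret_ge0.
have ud k : 0 <= ret k - ret k.+1 by have := ret_decr R Gam0 Gam_sym k; lra.
pose K := p%:R ^+ 5 / c'; have K0 : 0 < K by rewrite divr_gt0// exprn_gt0.
have term n : n.+1%:R * ret n <=
    K * (Num.sqrt n.+1%:R ^+ 3)^-1 + 4^-1 * ((n.+1 * n)%:R * (ret n - ret n.+1)).
  have [r /andP[rn nr]] := sqrt_bracket n p0.
  have n0 : 0 < n.+1%:R :> R by [].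
  have := ler_wpM2l (ltW n0) (ret_nash n r); rewrite mulrDr => /le_trans; apply.
  apply: lerD; last first.
    rewrite !mulrA ler_wpM2r// natrM mulrAC -[leLHS]mulrA [leRHS]mulrC.
    rewrite mulrA -!mulrA ler_pM2l//.
    have : (p ^ 2 * r ^ 2)%:R <= n%:R :> R by rewrite ler_nat.
    by rewrite natrM !natrX /p natrM; lra.
  set x : R := Num.sqrt n.+1%:R.
  have x0 : 0 < x by rewrite sqrtr_gt0.
  have xx : x ^+ 2 = n.+1%:R by rewrite sqr_sqrtr// ltW.
  have xp : x <= p%:R * r.+1%:R.
    suff : x ^+ 2 <= (p%:R * r.+1%:R) ^+ 2.
      by rewrite ler_pXn2r ?nnegrE ?(ltW x0) ?mulr_ge0.
    by rewrite xx exprMn -!natrX -natrM ler_nat.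
  have W0 : 0 < c' * r.+1%:R ^+ 5 by rewrite mulr_gt0// exprn_gt0.
  apply: (@le_trans _ _ (x ^+ 2 / (c' * r.+1%:R ^+ 5))).
    by rewrite -xx ler_wpM2l ?sqr_ge0// lef_pV2// posrE (lt_le_trans W0).
  rewrite ler_pdivrMr// /K.
  have -> (y z : R) : y / c' / x ^+ 3 * (c' * z) = y * z / x ^+ 3.
    by field; rewrite !gt_eqF.
  rewrite -exprMn ler_pdivlMr ?exprn_gt0// -exprD.
  by rewrite ler_pXn2r ?nnegrE ?(ltW x0) ?mulr_ge0.
(* The sum is at most 6 K plus half of itself, by [sum_inv_sqrt3_le] and [sum_weighted_decr]. *)
exists (12 * K) => [|L]; first by rewrite mulr_gt0.
have : \sum_(s < L) s.+1%:R * ret s <= \sum_(n < L)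
    (K * (Num.sqrt n.+1%:R ^+ 3)^-1 + 4^-1 * ((n.+1 * n)%:R * (ret n - ret n.+1))).
  by apply: ler_sum => s _; exact: term.
rewrite big_split/= -!mulr_sumr.
have := ler_wpM2l (ltW K0) (sum_inv_sqrt3_le R L).
have := sum_weighted_decr L u0; lra.
Qed.

End ReturnUpper.

(** * Divergence of the series for growth index at most 4 *)

Section ReturnLower.
Variables (R : realType) (G : groupType) (Gam : {fset G}).
Hypothesis Gam0 : Gam != fset0.
Hypothesis Gam_sym : symmetric_fset Gam.
Local Notation ret := (@ret R G Gam).
Local Notation mkv := (@mkv R G Gam).
Local Notation gball := (@gball R G Gam).
Local Notation vol n := ((volume R Gam n)%:R : R).
Implicit Types (f g : G -> R).

Lemma dot_diff2 f h : fsupp f -> fsupp h ->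
  fsum (fun x => (f x - h x) ^+ 2) = dot f f - 2 * dot f h + dot h h.
Proof.
move=> fs hs; have -> : (fun x => (f x - h x) ^+ 2) =
    (fun x => (f x * f x + f x * (-2 * h x)) + h x * h x).
  by apply/funext => x; ring.
rewrite fsumD ?fsumD; try (by exact: fsuppMl); last first.
  by apply: fsuppD; exact: fsuppMl.
have -> : fsum (fun x => f x * (-2 * h x)) = -2 * dot f h.
  by rewrite -fsumZ; congr fsum; apply/funext => x; ring.
rewrite /dot; lra.
Qed.

(** The difference is the squared norm of [f - mkv (mkv f)]. *)
Lemma dirichlet_mkv f : fsupp f -> dirichlet Gam (mkv f) <= dirichlet Gam f.
Proof.
move=> fs; have fs1 := fsupp_mkv Gam fs; have fs2 := fsupp_mkv Gam fs1.
have : 0 <= fsum (fun x => (f x - mkv (mkv f) x) ^+ 2).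
  by apply: fsum_ge0 => x; exact: sqr_ge0.
rewrite dot_diff2// -dot_mkvl// /dirichlet; lra.
Qed.

(* n |-> |P^n f|^2 is convex, so it lies above its tangent at 0. *)
Lemma dot_iter_ge f n : fsupp f ->
  dot f f - n%:R * dirichlet Gam f <= dot (iter n mkv f) (iter n mkv f).
Proof.
move=> fs; have fi k : fsupp (iter k mkv f) by exact: fsupp_iter.
have di k : dirichlet Gam (iter k mkv f) <= dirichlet Gam f.
  by elim: k => //= k; apply: le_trans; exact: dirichlet_mkv.
elim: n => [|n IHn]; first by rewrite mul0r subr0.
have := di n; rewrite {1}/dirichlet -[mkv (iter n mkv f)]/(iter n.+1 mkv f).
rewrite -[n.+1]addn1 natrD addn1; lra.
Qed.

(** By self-adjointness only the kernel at time 2n enters, and it is at most [ret n] everywhere. *)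
Lemma dot_iter_le f n : fsupp f -> (forall x, 0 <= f x) ->
  dot (iter n mkv f) (iter n mkv f) <= ret n * fsum f ^+ 2.
Proof.
move=> fs f0; rewrite dot_iterl//; last exact: fsupp_iter.
rewrite -iterD.
have le x : iter (n + n) mkv f x <= ret n * fsum f.
  rewrite -(fsum_delta (iter (n + n) mkv f) x) -/(dot _ _) dotC dot_iterl//;
    last exact: fsupp_delta.
  rewrite -fsumZ; apply: fsum_le => [||y]; [exact: fsuppMl|exact: fsuppMr|].
  rewrite iter_delta mulrC ler_wpM2r//; exact: ret_max.
rewrite expr2 mulrA -fsumZ; apply: fsum_le => [||x]; first exact: fsuppMl.
  exact: fsuppMr.
by rewrite [leLHS]mulrC ler_wpM2r.
Qed.

(** The positive part of r minus the word length of [x]. *)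
Definition tent r (x : G) : R := \sum_(k < r) (x \in gball k)%:R.

Lemma tent_ge0 r x : 0 <= tent r x. Proof. exact: sumr_ge0. Qed.

Lemma tent_eq0 r x : x \notin gball r -> tent r x = 0.
Proof.
move=> xr; rewrite /tent big1// => k _; case: (boolP (x \in gball k)) => // xk.
by rewrite (fsubsetP (gballS R Gam (ltnW (ltn_ord k))) _ xk) in xr.
Qed.

Lemma fsupp_tent r : fsupp (tent r).
Proof. by exists (gball r) => x; exact: tent_eq0. Qed.

Lemma tent_ge s x : x \in gball s -> s%:R <= tent (s + s) x.
Proof.
move=> xs; rewrite /tent big_split_ord/= ler_wpDl ?sumr_ge0//.
rewrite (eq_bigr (fun=> 1)); first by rewrite sumr_const card_ord.
by move=> k _; rewrite (fsubsetP (gballS R Gam (leq_addr k s)) _ xs).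
Qed.

Lemma tent_mulr r x y : y \in Gam -> tent r x - 1 <= tent r (x * y)%g.
Proof.
move=> yG; case: r => [|r]; first by rewrite /tent !big_ord0; lra.
rewrite /tent big_ord_recr [leRHS]big_ord_recl/=.
have : \sum_(k < r) (x \in gball k)%:R <= \sum_(k < r) ((x * y)%g \in gball k.+1)%:R :> R.
  apply: ler_sum => k _; rewrite ler_nat.
  by case: (boolP (x \in gball k)) => // xk; rewrite gball_mulr.
have : (x \in gball r)%:R <= 1 :> R by rewrite -[leRHS]/(1%:R) ler_nat leq_b1.
have : 0 <= ((x * y)%g \in gball 0)%:R :> R by [].
lra.
Qed.

Lemma tent_diff r x y : y \in Gam -> `|tent r x - tent r (x * y)%g| <= 1.
Proof.
move=> yG; have := tent_mulr r x yG.
have := @tent_mulr r (x * y)%g y^-1%g; rewrite memV// mulgK => /(_ yG).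
by rewrite ler_norml => *; apply/andP; split; lra.
Qed.

Lemma dirichlet_tent r : dirichlet Gam (tent r) <= 2 * vol r.+2.
Proof.
suff : 2 * dirichlet Gam (tent r) <= 4 * vol r.+2 by lra.
rewrite -avg_diff//; last exact: fsupp_tent.
rewrite -[leRHS](avg_cst Gam0); apply: le_avg => y yG.
rewrite -[leRHS](avg_cst Gam0); apply: le_avg => z zG.
have out x : x \notin gball r.+2 -> (tent r x - tent r (x * (y * z))%g) ^+ 2 = 0.
  move=> xr; rewrite !tent_eq0 ?subrr ?expr0n//.
    apply: contra xr => xr; rewrite -(mulgK (y * z)%g x) invgM mulgA.
    by rewrite !gball_mulr ?memV.
  by apply: contra xr; exact: (fsubsetP (gballS R Gam (leqW (leqnSn r)))).
rewrite (fsumE out) volumeE.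
apply: (@le_trans _ _ (\sum_(x <- gball r.+2) 4)).
  apply: ler_sum => x _; have := tent_diff r x yG; have := tent_diff r (x * y)%g zG.
  rewrite mulgA !ler_norml; nra.
by rewrite big_const_seq count_predT iter_addr_0 -[leLHS]mulr_natr.
Qed.

(* The tent function of radius 2s is at least s on a ball of radius s and has gradient
   at most 1, so its Rayleigh quotient is of order s^-2. *)
Lemma ret_ge s n : (0 < s)%N ->
  4 * n%:R * vol (s + s).+2 <= s%:R ^+ 2 * vol s -> 1 <= 2 * vol (s + s) * ret n.
Proof.
move=> s0 H; set f := tent (s + s).
have fs : fsupp f by exact: fsupp_tent.
have sr0 : 0 < s%:R :> R by rewrite ltr0n.
have f2 : s%:R ^+ 2 * vol s <= dot f f.
  rewrite /dot (@fsumE _ _ _ (gball (s + s))); last by move=> x xs; rewrite /f tent_eq0 ?mul0r.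
  rewrite (big_fsetID _ (mem (gball s)))/= ler_wpDr//.
    by apply: sumr_ge0 => x _; rewrite mulr_ge0 ?tent_ge0.
  rewrite (_ : [fset x in _ | _]%fset = gball s); last first.
    apply/fsetP => x; rewrite !inE /= andbC.
    by case: (boolP (x \in gball s)) => //= /(fsubsetP (gballS R Gam (leq_addr s s))) ->.
  rewrite volumeE mulr_natr -iter_addr_0 -[in leLHS](count_predT (gball s)) -big_const_seq.
  rewrite big_seq [leRHS]big_seq; apply: ler_sum => x xs.
  by rewrite -expr2 ler_pXn2r ?nnegrE ?tent_ge0 ?tent_ge// ltW.
have dp : 0 < dot f f.
  apply: lt_le_trans f2; rewrite mulr_gt0 ?exprn_gt0// volumeE ltr0n cardfs_gt0.
  by apply/fset0Pn; exists 1%g; apply/gballP; exists 0%N; rewrite ?inE.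
(* Cauchy-Schwarz on the support, from the quadratic in l at its minimum. *)
have f1 : fsum f ^+ 2 <= vol (s + s) * dot f f.
  have E (l : R) : 0 <= vol (s + s) - 2 * l * fsum f + l ^+ 2 * dot f f.
    rewrite /dot !(@fsumE _ _ _ (gball (s + s))); last 2 first.
    - by move=> x xs; rewrite /f tent_eq0 ?mul0r.
    - by move=> x xs; rewrite /f tent_eq0.
    have -> : vol (s + s) = \sum_(x <- gball (s + s)) 1.
      by rewrite big_const_seq count_predT iter_addr_0 volumeE.
    rewrite !mulr_sumr -sumrB -big_split /=; apply: sumr_ge0 => x _.
    by have := sqr_ge0 (1 - l * f x); lra.
  have := E (fsum f / dot f f); rewrite -(@ler_pM2r _ (dot f f))// mul0r.
  have -> : (vol (s + s) - 2 * (fsum f / dot f f) * fsum f +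
    (fsum f / dot f f) ^+ 2 * dot f f) * dot f f = vol (s + s) * dot f f - fsum f ^+ 2.
    by field; rewrite gt_eqF.
  lra.
have := dot_iter_le n fs (tent_ge0 (s + s)).
have := dot_iter_ge n fs; have := dirichlet_tent (s + s); rewrite -/f.
move=> h1 h2 h3.
have h4 : n%:R * dirichlet Gam f <= n%:R * (2 * vol (s + s).+2) by rewrite ler_wpM2l.
have h5 : ret n * fsum f ^+ 2 <= ret n * (vol (s + s) * dot f f).
  by rewrite ler_wpM2l// ret_ge0.
rewrite -(@ler_pM2r _ (dot f f))//; lra.
Qed.

(** With s of order sqrt n, [ret_ge] bounds [ret n] below by a multiple of s^-d, hence of n^-2 as d
    <= 4; the series then dominates the harmonic one. *)
Lemma ret_not_summable d : polynomial_growth R Gam d -> (d <= 4)%N ->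
  forall B : R, exists L, B <= \sum_(s < L) s.+1%:R * ret s.
Proof.
move=> [c [C [c0 C0 HV]]] d4.
(* The factor 4^d comes from 2 s + 2 <= 4 s. *)
have [C1 C1E] : exists C1, C1 = C * 4 ^+ d by exists (C * 4 ^+ d).
have C10 : 0 < C1 by rewrite C1E mulr_gt0// exprn_gt0.
(* A makes s = A j large enough, given n <= j^2, for the hypothesis of [ret_ge]. *)
pose A := (Num.bound (4 * C1 / c)).+1.
have AP : 4 * C1 <= c * A%:R.
  rewrite [leRHS]mulrC -ler_pdivrMr// ltW//; apply: lt_le_trans (archi_boundP _) _.
    by rewrite divr_ge0// ltW// mulr_gt0.
  by rewrite ler_nat.
have A1 : 1 <= A%:R :> R by rewrite ler1n.
pose K := 2 * C1 * (16 * A%:R ^+ 4); have K0 : 0 < K by rewrite !mulr_gt0// exprn_gt0.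
have term n : (0 < n)%N -> K^-1 * n.+1%:R^-1 <= n.+1%:R * ret n.
  move=> n0; have [j /andP[j1 j2]] := sqrt_ceil n0.
  have j0 : (0 < j)%N by case: j j1 {j2} => //; rewrite leqn0; case: n n0.
  pose s := (A * j)%N; have s0 : (0 < s)%N by rewrite muln_gt0.
  have sr : 1 <= s%:R :> R by rewrite ler1n.
  have v1 : vol (s + s).+2 <= C1 * s%:R ^+ d.
    have /andP[_] := HV (s + s).+2 isT; move/le_trans; apply.
    rewrite C1E -mulrA ler_pM2l// -exprMn -natrM -!natrX ler_nat.
    by case: (d) => // d'; rewrite leq_exp2r//; lia.
  have v2 : vol (s + s) <= C1 * s%:R ^+ d.
    by apply: le_trans v1; rewrite ler_nat !volumeE fsubset_leq_card// gballS// leqW.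
  have v3 : c * s%:R ^+ d <= vol s by have /andP[] := HV s s0.
  have sd0 : 0 < s%:R ^+ d :> R by rewrite exprn_gt0// (lt_le_trans _ sr).
  have : 1 <= 2 * vol (s + s) * ret n.
    apply: ret_ge => //.
    apply: (@le_trans _ _ (4 * n%:R * (C1 * s%:R ^+ d))); first by rewrite ler_wpM2l// mulr_ge0.
    apply: (@le_trans _ _ (s%:R ^+ 2 * (c * s%:R ^+ d))); last by rewrite ler_wpM2l// sqr_ge0.
    rewrite !mulrA ler_pM2r//.
    have : n%:R <= j%:R ^+ 2 :> R by rewrite -natrX ler_nat.
    rewrite /s natrM => nj.
    have h1 : 4 * n%:R * C1 <= 4 * C1 * j%:R ^+ 2.
      by rewrite mulrAC ler_wpM2l// mulr_ge0// ltW.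
    apply: le_trans h1 _; apply: (@le_trans _ _ (c * A%:R * j%:R ^+ 2)).
      by rewrite ler_wpM2r// sqr_ge0.
    rewrite exprMn [leRHS]mulrC [leRHS]mulrA ler_wpM2r ?sqr_ge0//.
    by rewrite ler_pM2l// ler_eXnr.
  move=> h; have r0 : 0 <= ret n by exact: ret_ge0.
  have v4 : C1 * s%:R ^+ d <= C1 * (16 * A%:R ^+ 4) * n%:R ^+ 2.
    rewrite -mulrA ler_pM2l//; apply: (@le_trans _ _ (s%:R ^+ 4)); first by rewrite ler_weXn2l.
    rewrite /s natrM exprMn [16 * _]mulrC -[leRHS]mulrA ler_pM2l ?exprn_gt0//.
    have : j%:R ^+ 2 <= 4 * n%:R :> R by rewrite -natrX -natrM ler_nat.
    move=> h2; have -> : j%:R ^+ 4 = (j%:R ^+ 2) ^+ 2 :> R by rewrite -exprM.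
    have -> : 16 * n%:R ^+ 2 = (4 * n%:R) ^+ 2 :> R by rewrite exprMn; ring.
    by rewrite ler_pXn2r ?nnegrE ?sqr_ge0 ?mulr_ge0.
  have h2 : 1 <= K * n.+1%:R ^+ 2 * ret n.
    apply: le_trans h _; rewrite ler_wpM2r// /K.
    apply: (@le_trans _ _ (2 * (C1 * (16 * A%:R ^+ 4) * n%:R ^+ 2))).
      by rewrite ler_pM2l// (le_trans v2).
    have nn : n%:R ^+ 2 <= n.+1%:R ^+ 2 :> R by rewrite ler_pXn2r ?nnegrE// ler_nat.
    by have := ler_wpM2l (ltW K0) nn; rewrite /K !mulrA.
  rewrite -invfM -div1r ler_pdivrMr ?mulr_gt0//.
  by apply: le_trans h2 _; rewrite le_eqVlt; apply/orP; left; apply/eqP; ring.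
(* The extra K^-1 pays for the index 0, which [term] excludes. *)
move=> B; have [L LP] := harmonic_unbounded (K * (`|B| + K^-1)).
exists L; apply: le_trans (ler_norm B) _.
have hK : `|B| + K^-1 <= \sum_(n < L) K^-1 * n.+1%:R^-1.
  by rewrite -mulr_sumr mulrC ler_pdivlMr// mulrC.
have r0 k : 0 <= ret k by exact: ret_ge0.
have Ki : 0 < K^-1 by rewrite invr_gt0.
case: L hK {LP} => [|L]; first by rewrite !big_ord0; lra.
rewrite !big_ord_recl /= invr1 mulr1 mul1r => hK.
have : \sum_(i < L) K^-1 * (bump 0 i).+1%:R^-1 <= \sum_(i < L) (bump 0 i).+1%:R * ret (bump 0 i).
  by apply: ler_sum => i _; exact: term.
have := r0 0%N; lra.
Qed.

End ReturnLower.

(** * The empty generating set and the final dichotomy *)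

(** Division by zero gives 0, so a uniform law on the empty set would have total mass 0. *)
Lemma no_steps_fset0 (R : realType) (G : groupType) (disp : measure_display)
    (T : measurableType disp) (P : probability T R) (X : nat -> T -> G) :
  ~ iid_uniform_steps (fset0 : {fset G}) P X.
Proof.
move=> [_ /(_ 0%N setT) + _]; rewrite preimage_setT probability_setT cardfs0 invr0 mulr0.
by move=> [] /eqP; rewrite oner_eq0.
Qed.

Lemma volume_ge_pow5 (R : realType) (G : groupType) (Gam : {fset G}) (d : extnat) :
  has_growth_index R Gam d -> ~~ extnat_le d 4 ->
  exists2 c : R, 0 < c & forall n, (1 <= n)%N -> c * n%:R ^+ 5 <= (volume R Gam n)%:R.
Proof.
case: d => [d|] /=.
  move=> [c [C [c0 _ Hc]]]; rewrite -ltnNge => d4; exists c => // n n1.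
  have /andP[+ _] := Hc n n1; apply: le_trans.
  by rewrite ler_pM2l// ler_weXn2l// ler1n.
move=> /(_ 5 (ler0n _ 5))[c c0 Hc] _; exists c => // n n1.
by have := Hc n n1; rewrite powR_mulrn.
Qed.

Theorem theorem1p1 (R : realType) (G : groupType) (Gamma : {fset G})
    (d : extnat) (hsym : symmetric_fset Gamma) (hgen : generates Gamma)
    (hd : has_growth_index R Gamma d) :
  exists mu : R,
    [/\ 0 <= mu,
        forall (disp : measure_display) (T : measurableType disp)
          (P : probability T R) (X : nat -> T -> G),
          iid_uniform_steps Gamma P X ->
          {ae P, forall w,
            (fun n : nat => (capacity_of_range P X n w * (n%:R^-1)%:E)%E)
              @ \oo --> mu%:E} &
        mu = 0 <-> extnat_le d 4].
Proof.
have mcap0 := mcap_ge0 R.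
(* With no generators the convergence is vacuous and the rate 0 is chosen; the balls have at most
   one point, which rules out d > 4. *)
have [G0|Gam0] := eqVneq Gamma fset0.
  exists 0; split => // [disp T P X|]; first by rewrite G0 => /no_steps_fset0.
  split=> // _; apply: contrapT => /negP d4.
  have [c c0 Hc] := volume_ge_pow5 hd d4; rewrite G0 in Hc.
  have : c <= 0.
    apply: (@archi_le _ _ _ 1) => k; rewrite mulr0 add0r.
    case: k => [|k]; first by rewrite mul0r.
    have /le_trans := Hc k.+1 isT; move=> /(_ 1) H.
    apply: le_trans (H _); last by rewrite -[leRHS]/(1%:R) ler_nat volume_fset0.
    by rewrite mulrC ler_pM2l// ler_eXnr// ler1n.
  by rewrite leNgt c0.
exists (growth_rate (mcap R Gamma)); split.
- exact/growth_rate_ge0/mcap0.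
- move=> disp T P X iid; exact: ae_cvg_capacity.
split=> [mu0|].
  apply: contrapT => /negP d4; have [c c0 Hc] := volume_ge_pow5 hd d4.
  have [K K0 HK] := ret_summable Gam0 hsym c0 Hc.
  by have := growth_rate_gt0 Gam0 hsym K0 HK; rewrite mu0 ltxx.
case: d hd => // d hd d4; apply: growth_rate_eq0 => //.
exact: ret_not_summable hd d4.
Qed.
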